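(* Let $(\mathcal T,[1],\Delta)$ be a triangulated category and $\xi$ a proper class of triangles. Suppose that $\mathcal X$ and $\mathcal Y$ are additive full subcategories of $\mathcal T$ closed under isomorphisms and direct summands, and put $\omega=\mathcal X\cap\mathcal Y$. Define $$\mathrm{CoFib}_\omega^\xi=\{\xi\text{-proper monomorphisms } f\mid \mathrm{hoCoker} f\in\mathcal X\},$$ $$\mathrm{Fib}_\omega^\xi=\{\text{morphisms } f\mid \mathrm{Hom}_{\mathcal T}(W,f)\text{ is surjective for all }W\in\omega\},$$ $$\mathrm{Weq}_\omega^\xi=\{f:A\to B\mid \text{there is a }\xi\text{-proper epimorphism }(f,t):A\oplus W\to B\text{ with }W\in\omega\text{ and }\mathrm{hoKer}(f,t)\in\mathcal Y\}.$$ Then $(\mathrm{CoFib}_\omega^\xi,\mathrm{Fib}_\omega^\xi,\mathrm{Weq}_\omega^\xi)$ is a model structure on $\mathcal T$ if and only if $(\mathcal X,\mathcal Y)$ is a hereditary complete cotorsion pair in $\mathcal T$ with respect to $\xi$ and $\omega$ is contravariantly finite in $\mathcal T$. If this is the case, then the class $\mathrm{CoFib}_\omega^\xi\cap\mathrm{Weq}_\omega^\xi$ of trivial cofibrations is precisely the class of splitting monomorphisms with hocokernel in $\omega$, and the class $\mathrm{Fib}_\omega^\xi\cap\mathrm{Weq}_\omega^\xi$ of trivial fibrations is precisely the class of $\xi$-proper epimorphisms with hokernel in $\mathcal Y$; the class of cofibrant objects (respectively, fibrant objects, trivial objects) is $\mathcal X$ (respectively, $\mathcal T$, $\mathcal Y$);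 and the homotopy category is equivalent to the additive quotient $\mathcal X/\omega$.
   Context: $(\mathcal T,[1],\Delta)$ denotes a triangulated category with suspension autoequivalence $[1]$ (quasi-inverse $[-1]$) and class $\Delta$ of (distinguished) triangles. A triangle $X\xrightarrow{u}Y\xrightarrow{v}Z\xrightarrow{w}X[1]$ is splitting if $w=0$. A class $\xi\subseteq\Delta$ is a proper class of triangles if: (i) it contains all splitting triangles; (ii) it is closed under isomorphisms of triangles, finite coproducts and suspensions (if $X\xrightarrow{u}Y\xrightarrow{v}Z\xrightarrow{w}X[1]$ is in $\xi$ then so is $X[i]\xrightarrow{(-1)^iu[i]}Y[i]\xrightarrow{(-1)^iv[i]}Z[i]\xrightarrow{(-1)^iw[i]}X[i+1]$ for all $i\in\mathbb Z$); (iii) it is closed under base changes (if $X\to Y\to Z\xrightarrow{w}X[1]$ is in $\xi$ and $\alpha:Z'\to Z$ is any morphism, then the triangle $X\to Y'\to Z'\xrightarrow{w\alpha}X[1]$ is in $\xi$) and cobase changes (if moreover $\beta:X\to X'$ is any morphism, then the triangle $X'\to Y'\to Z\xrightarrow{\beta[1]w}X'[1]$ is in $\xi$); (iv) it is saturated: for any triangle $X\to Y\to Z\xrightarrow{w}X[1]$ and any morphism $\alpha:Z'\to Z$ embedded in a triangle $X'\to Z'\xrightarrow{\alpha}Z\to X'[1]$ in $\xi$, if the base change $X\to Y'\to Z'\xrightarrow{w\alpha}X[1]$ is in $\xi$, then $X\to Y\to Z\xrightarrow{w}X[1]$ is in $\xi$. A morphism $u:X\to Y$ is a $\xi$-proper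 monomorphism if there is a triangle $X\xrightarrow{u}Y\to Z\to X[1]$ in $\xi$, and a $\xi$-proper epimorphism if there is a triangle $Z[-1]\to X\xrightarrow{u}Y\to Z$ in $\xi$. For $u:X\to Y$, the hocokernel $\mathrm{hoCoker}\,u$ is the object $Z$ in a triangle $X\xrightarrow{u}Y\to Z\to X[1]$, and the hokernel $\mathrm{hoKer}\,u$ is the object $W$ in a triangle $W\to X\xrightarrow{u}Y\to W[1]$ (unique up to isomorphism). $\mathrm{Ext}_\xi(X,Y)$ is the abelian group (under Baer sum) of equivalence classes of triangles $Y\to E\to X\to Y[1]$ in $\xi$, two such triangles being equivalent if there is a morphism of triangles between them which is the identity on $Y$ and on $X$; the zero element is the class of the splitting triangle. A pair $(\mathcal X,\mathcal Y)$ of classes of objects is a cotorsion pair with respect to $\xi$ if $\mathcal Y=\{Z\mid \mathrm{Ext}_\xi(X,Z)=0\ \forall X\in\mathcal X\}$ and $\mathcal X=\{Z\mid \mathrm{Ext}_\xi(Z,Y)=0\ \forall Y\in\mathcal Y\}$. It is complete if for each $T\in\mathcal T$ there are triangles $Y\to X\to T\to Y[1]$ and $T\to Y'\to X'\to T[1]$ in $\xi$ with $X,X'\in\mathcal X$, $Y,Y'\in\mathcal Y$. It is hereditary if: for every triangle $K\to X_1\to X_2\to K[1]$ in $\xi$ with $X_1,X_2\in\mathcal X$ one has $K\in\mathcal X$; and for every triangle $Y_1\to Y_2\to C\to Y_1[1]$ in $\xi$ with $Y_1,Y_2\in\mathcal Y$ one has $C\in\mathcal Y$. $\omega$ is contravariantly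 finite in $\mathcal T$ if each $T\in\mathcal T$ has a right $\omega$-approximation, i.e. a morphism $W\to T$ with $W\in\omega$ through which every morphism $W'\to T$ with $W'\in\omega$ factors. $\mathcal X/\omega$ is the quotient of $\mathcal X$ by the ideal of morphisms factoring through objects of $\omega$. A model structure on a category is a triple $(\mathrm{CoFib},\mathrm{Fib},\mathrm{Weq})$ of classes of morphisms (cofibrations, fibrations, weak equivalences) satisfying: $\mathrm{Weq}$ has the two-out-of-three property; each class is closed under retracts; every commutative square with left side $i\in\mathrm{CoFib}$ and right side $p\in\mathrm{Fib}$ has a lifting if $i\in\mathrm{Weq}$ or $p\in\mathrm{Weq}$; every morphism factors as $pi=qj$ with $i\in\mathrm{CoFib}\cap\mathrm{Weq}$, $p\in\mathrm{Fib}$, $j\in\mathrm{CoFib}$, $q\in\mathrm{Fib}\cap\mathrm{Weq}$. (No existence of limits or colimits is assumed.) An object $X$ is cofibrant if $0\to X$ is a cofibration, fibrant if $X\to0$ is a fibration, trivial if $0\to X$ (equivalently $X\to 0$) is a weak equivalence. The homotopy category is the localization of the category at $\mathrm{Weq}$. *)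

(* Defs.v *)
From HB Require Import structures.
From mathcomp Require Import all_boot all_algebra boolp.
From mathcomp Require Import generic_quotient.

Set Implicit Arguments.
Unset Strict Implicit.
Unset Printing Implicit Defensive.

Import GRing.Theory.

Local Open Scope ring_scope.
Local Open Scope quotient_scope.

#[local] Obligation Tactic := idtac.

(** ** Categories, functors, equivalences *)

Record category := Category {
  obj :> Type;
  hom : obj -> obj -> Type;
  idm : forall A, hom A A;
  comp : forall A B C, hom B C -> hom A B -> hom A C;
  comp1m : forall A B (f : hom A B), comp (idm B) f = f;
  compm1 : forall A B (f : hom A B), comp f (idm A) = f;
  compmA : forall A B C D (h : hom C D) (g : hom B C) (f : hom A B),
    comp h (comp g f) = comp (comp h g) f }.

Arguments idm {c} A.
Arguments comp {c A B C} g f.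

HB.instance Definition _ (C : category) (A B : C) := gen_eqMixin (hom A B).
HB.instance Definition _ (C : category) (A B : C) := gen_choiceMixin (hom A B).

Notation "g ∘ f" := (comp g f) (at level 40, left associativity).

Definition is_iso (C : category) (A B : C) (f : hom A B) : Prop :=
  exists g : hom B A, g ∘ f = idm A /\ f ∘ g = idm B.

Definition isomorphic (C : category) (A B : C) : Prop :=
  exists f : hom A B, is_iso f.

Record functor (C D : category) := Functor {
  fobj :> C -> D;
  fmor : forall A B, hom A B -> hom (fobj A) (fobj B);
  fmor1 : forall A, fmor (idm A) = idm (fobj A);
  fmorM : forall A B E (g : hom B E) (f : hom A B),
    fmor (g ∘ f) = fmor g ∘ fmor f }.

Arguments fmor {C D} F {A B} f : rename.

Notation "F @@ f" := (fmor F f) (at level 30, right associativity).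

Definition functor_id (C : category) : functor C C :=
  @Functor C C id (fun _ _ => id) (fun=> erefl) (fun _ _ _ _ _ => erefl).

Program Definition functor_comp (C D E : category)
    (G : functor D E) (F : functor C D) : functor C E :=
  @Functor C E (fun A => G (F A)) (fun _ _ f => G @@ F @@ f) _ _.
Next Obligation. by move=> * /=; rewrite !fmor1. Qed.
Next Obligation. by move=> * /=; rewrite !fmorM. Qed.

Definition naturally_isomorphic (C D : category) (F G : functor C D) : Prop :=
  exists a : forall A, hom (F A) (G A),
    (forall A, is_iso (a A)) /\
    (forall A B (f : hom A B), a B ∘ (F @@ f) = (G @@ f) ∘ a A).

Definition equivalent_categories (C D : category) : Prop :=
  exists (F : functor C D) (G : functor D C),
    naturally_isomorphic (functor_comp G F) (functor_id C) /\
    naturally_isomorphic (functor_comp F G) (functor_id D).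

Program Definition full_subcategory (C : category) (P : C -> Prop) : category :=
  @Category {A : C | P A} (fun A B => hom (sval A) (sval B))
    (fun A => idm (sval A)) (fun _ _ _ g f => g ∘ f) _ _ _.
Next Obligation. by move=> * /=; rewrite comp1m. Qed.
Next Obligation. by move=> * /=; rewrite compm1. Qed.
Next Obligation. by move=> * /=; rewrite compmA. Qed.

(** ** Quotient of a category by a congruence *)

Record congruence (C : category) := Congruence {
  cong : forall A B : C, hom A B -> hom A B -> Prop;
  cong_refl : forall A B (f : hom A B), cong f f;
  cong_sym : forall A B (f g : hom A B), cong f g -> cong g f;
  cong_trans : forall A B (f g h : hom A B), cong f g -> cong g h -> cong f h;
  cong_comp : forall A B D (f f' : hom A B) (g g' : hom B D),
    cong f f' -> cong g g' -> cong (g ∘ f) (g' ∘ f') }.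

Section QuotientCategory.
Variables (C : category) (R : congruence C).

Section Hom.
Variables A B : C.

Definition cong_bool (f g : hom A B) : bool := `[< cong R f g >].

Lemma cong_bool_equiv : equiv_class_of cong_bool.
Proof.
split=> [f|f g|g f h].
- exact/asboolP/cong_refl.
- by apply/asboolP/asboolP; apply: cong_sym.
- by move=> /asboolP fg /asboolP gh; apply/asboolP/(cong_trans fg gh).
Qed.

Canonical cong_equiv_rel := EquivRelPack cong_bool_equiv.

Definition quot_hom := {eq_quot cong_equiv_rel}.

Definition quot_class (f : hom A B) : quot_hom :=
  \pi_quot_hom f.

Definition quot_repr (f : quot_hom) : hom A B := repr f.

Lemma quot_reprK (f : quot_hom) : quot_class (quot_repr f) = f.
Proof. exact: reprK. Qed.

Lemma quot_classP (f g : hom A B) : quot_class f = quot_class g <-> cong R f g.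
Proof.
split=> [/eqP|fg]; first by rewrite eqmodE => /asboolP.
by apply/eqP; rewrite eqmodE; apply/asboolP.
Qed.

Lemma cong_repr (f : hom A B) : cong R (quot_repr (quot_class f)) f.
Proof. by apply/quot_classP; rewrite quot_reprK. Qed.
End Hom.

Definition quot_comp (A B D : C) (g : quot_hom B D) (f : quot_hom A B) :
    quot_hom A D :=
  quot_class (quot_repr g ∘ quot_repr f).

Program Definition quotient_category : category :=
  @Category C quot_hom (fun A => quot_class (idm A)) quot_comp _ _ _.
Next Obligation.
move=> A B f; rewrite -[RHS]quot_reprK; apply/quot_classP.
rewrite -[X in cong R _ X]comp1m.
by apply: cong_comp; [apply: cong_refl|apply: cong_repr].
Qed.
Next Obligation.
move=> A B f; rewrite -[RHS]quot_reprK; apply/quot_classP.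
rewrite -[X in cong R _ X]compm1.
by apply: cong_comp; [apply: cong_repr|apply: cong_refl].
Qed.
Next Obligation.
move=> A B D E h g f; apply/quot_classP.
apply: (cong_trans (g := quot_repr h ∘ (quot_repr g ∘ quot_repr f))).
  by apply: cong_comp; [apply: cong_repr|apply: cong_refl].
rewrite compmA; apply: cong_comp; first exact: cong_refl.
exact/cong_sym/cong_repr.
Qed.
End QuotientCategory.

(** ** Localization: zigzags modulo the usual relations (Gabriel-Zisman) *)

Definition mor_class (C : category) := forall A B : C, hom A B -> Prop.

Section Localization.
Variables (C : category) (W : mor_class C).

Inductive zigzag : C -> C -> Type :=
| znil A : zigzag A A
| zfwd A B D (f : hom A B) (p : zigzag B D) : zigzag A D
| zbwd A B D (s : hom B A) (Ws : W s) (p : zigzag B D) : zigzag A D.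

Fixpoint zcat A B D (p : zigzag A B) : zigzag B D -> zigzag A D :=
  match p in zigzag A B return zigzag B D -> zigzag A D with
  | znil _ => id
  | zfwd _ _ _ f p' => fun q => zfwd f (zcat p' q)
  | zbwd _ _ _ s Ws p' => fun q => zbwd Ws (zcat p' q)
  end.

Lemma zcat0 A B (p : zigzag A B) : zcat p (znil B) = p.
Proof. by elim: p => //= *; f_equal. Qed.

Lemma zcatA A B D E (p : zigzag A B) (q : zigzag B D) (r : zigzag D E) :
  zcat (zcat p q) r = zcat p (zcat q r).
Proof. by elim: p q => //= *; f_equal. Qed.

Definition zigzag_category : category :=
  @Category C zigzag znil (fun _ _ _ q p => zcat p q)
    (fun _ _ p => zcat0 p) (fun _ _ _ => erefl) (fun _ _ _ _ r q p => zcatA p q r).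

Inductive zigzag_rel : forall A B, zigzag A B -> zigzag A B -> Prop :=
| zr_refl A B (p : zigzag A B) : zigzag_rel p p
| zr_sym A B (p q : zigzag A B) : zigzag_rel p q -> zigzag_rel q p
| zr_trans A B (p q r : zigzag A B) :
    zigzag_rel p q -> zigzag_rel q r -> zigzag_rel p r
| zr_cat A B D (p p' : zigzag A B) (q q' : zigzag B D) :
    zigzag_rel p p' -> zigzag_rel q q' -> zigzag_rel (zcat p q) (zcat p' q')
| zr_id A : zigzag_rel (zfwd (idm A) (znil A)) (znil A)
| zr_comp A B D (f : hom A B) (g : hom B D) :
    zigzag_rel (zfwd f (zfwd g (znil D))) (zfwd (g ∘ f) (znil D))
| zr_fwd_bwd A B (s : hom A B) (Ws : W s) :
    zigzag_rel (zfwd s (zbwd Ws (znil A))) (znil A)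
| zr_bwd_fwd A B (s : hom A B) (Ws : W s) :
    zigzag_rel (zbwd Ws (zfwd s (znil B))) (znil B).

Definition zigzag_congruence : congruence zigzag_category :=
  @Congruence zigzag_category zigzag_rel zr_refl zr_sym zr_trans zr_cat.

Definition localization : category := quotient_category zigzag_congruence.
End Localization.

(** ** Model structures *)

Definition two_out_of_three (C : category) (W : mor_class C) : Prop :=
  forall (A B D : C) (f : hom A B) (g : hom B D),
    (W _ _ f -> W _ _ g -> W _ _ (g ∘ f)) /\
    (W _ _ f -> W _ _ (g ∘ f) -> W _ _ g) /\
    (W _ _ g -> W _ _ (g ∘ f) -> W _ _ f).

Definition is_retract (C : category) (A B A' B' : C)
    (f : hom A B) (g : hom A' B') : Prop :=
  exists (i : hom A A') (r : hom A' A) (j : hom B B') (q : hom B' B),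
    [/\ r ∘ i = idm A, q ∘ j = idm B, g ∘ i = j ∘ f & f ∘ r = q ∘ g].

Definition closed_under_retracts (C : category) (M : mor_class C) : Prop :=
  forall (A B A' B' : C) (f : hom A B) (g : hom A' B'),
    is_retract f g -> M _ _ g -> M _ _ f.

Definition has_lifting (C : category) (A B D E : C)
    (i : hom A B) (p : hom D E) : Prop :=
  forall (a : hom A D) (b : hom B E), p ∘ a = b ∘ i ->
    exists h : hom B D, h ∘ i = a /\ p ∘ h = b.

Record is_model_structure (C : category) (cof fib weq : mor_class C) : Prop := {
  ms_two_three : two_out_of_three weq;
  ms_retract_cof : closed_under_retracts cof;
  ms_retract_fib : closed_under_retracts fib;
  ms_retract_weq : closed_under_retracts weq;
  ms_lift : forall (A B D E : C) (i : hom A B) (p : hom D E),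
    cof _ _ i -> fib _ _ p -> weq _ _ i \/ weq _ _ p -> has_lifting i p;
  ms_fact_tcof_fib : forall (A B : C) (f : hom A B),
    exists (E : C) (i : hom A E) (p : hom E B),
      [/\ f = p ∘ i, cof _ _ i, weq _ _ i & fib _ _ p];
  ms_fact_cof_tfib : forall (A B : C) (f : hom A B),
    exists (E : C) (j : hom A E) (q : hom E B),
      [/\ f = q ∘ j, cof _ _ j, fib _ _ q & weq _ _ q] }.

(** ** Additive categories *)


Record preadditive_category := PreadditiveCategory {
  preadd_cat :> category;
  hom_zmod : forall A B : preadd_cat, GRing.isZmodule (hom A B) }.

HB.instance Definition _ (C : preadditive_category) (A B : C) :=
  hom_zmod A B.

Record additive_category := AdditiveCategory {
  add_cat :> preadditive_category;
  compDl : forall (A B D : add_cat) (g g' : hom B D) (f : hom A B),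
    (g + g') ∘ f = g ∘ f + g' ∘ f;
  compDr : forall (A B D : add_cat) (g : hom B D) (f f' : hom A B),
    g ∘ (f + f') = g ∘ f + g ∘ f';
  zero_obj : add_cat;
  to_zero_obj : forall (A : add_cat) (f : hom A zero_obj), f = 0;
  from_zero_obj : forall (A : add_cat) (f : hom zero_obj A), f = 0;
  bip : add_cat -> add_cat -> add_cat;
  in1 : forall A B, hom A (bip A B);
  in2 : forall A B, hom B (bip A B);
  pr1 : forall A B, hom (bip A B) A;
  pr2 : forall A B, hom (bip A B) B;
  pr1_in1 : forall A B, pr1 A B ∘ in1 A B = idm A;
  pr2_in2 : forall A B, pr2 A B ∘ in2 A B = idm B;
  pr1_in2 : forall A B, pr1 A B ∘ in2 A B = 0;
  pr2_in1 : forall A B, pr2 A B ∘ in1 A B = 0;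
  bip_id : forall A B,
    in1 A B ∘ pr1 A B + in2 A B ∘ pr2 A B = idm (bip A B) }.

Arguments zero_obj {a}.
Arguments in1 {a A B}.
Arguments in2 {a A B}.
Arguments pr1 {a A B}.
Arguments pr2 {a A B}.

Notation "A ⊕ B" := (bip A B) (at level 50, left associativity).

Definition bip_map (T : additive_category) (A A' B B' : T)
    (f : hom A B) (g : hom A' B') : hom (A ⊕ A') (B ⊕ B') :=
  in1 ∘ f ∘ pr1 + in2 ∘ g ∘ pr2.

(* The morphism (f, t) : A ⊕ W -> B. *)
Definition copair (T : additive_category) (A W B : T)
    (f : hom A B) (t : hom W B) : hom (A ⊕ W) B :=
  f ∘ pr1 + t ∘ pr2.

(** ** Additive subcategories and their additive quotients *)

(* Full subcategories, given by their class of objects. *)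
Record additive_subcategory (T : additive_category) := AdditiveSubcategory {
  sub_mem :> T -> Prop;
  sub_zero : sub_mem zero_obj;
  sub_bip : forall A B, sub_mem A -> sub_mem B -> sub_mem (A ⊕ B);
  sub_iso : forall A B, isomorphic A B -> sub_mem A -> sub_mem B;
  sub_summand : forall A B, sub_mem (A ⊕ B) -> sub_mem A /\ sub_mem B }.

Program Definition subcategory_meet (T : additive_category)
    (X Y : additive_subcategory T) : additive_subcategory T :=
  @AdditiveSubcategory T (fun A => X A /\ Y A) _ _ _ _.
Next Obligation. by move=> *; split; apply: sub_zero. Qed.
Next Obligation. by move=> T X Y A B [? ?] [? ?]; split; apply: sub_bip. Qed.
Next Obligation.
by move=> T X Y A B AB [XA YA]; split; [apply: sub_iso AB XA|apply: sub_iso AB YA].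
Qed.
Next Obligation.
by move=> T X Y A B [/sub_summand[? ?] /sub_summand[? ?]].
Qed.

Definition factors_through (C : category) (w : C -> Prop) (A B : C)
    (f : hom A B) : Prop :=
  exists W : C, w W /\ exists (a : hom A W) (b : hom W B), f = b ∘ a.

Section AdditiveQuotient.
Variables (T : additive_category) (X w : additive_subcategory T).

Definition sub_quot_rel (A B : full_subcategory X) (f g : hom A B) : Prop :=
  factors_through w ((f : hom (sval A) (sval B)) - g).

Lemma comp0m (A B D : T) (f : hom A B) : (0 : hom B D) ∘ f = 0.
Proof. by apply: (addrI (0 ∘ f)); rewrite -compDl !addr0. Qed.

Lemma compm0 (A B D : T) (g : hom B D) : g ∘ (0 : hom A B) = 0.
Proof. by apply: (addrI (g ∘ 0)); rewrite -compDr !addr0. Qed.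

Lemma compNm (A B D : T) (g : hom B D) (f : hom A B) : (- g) ∘ f = - (g ∘ f).
Proof. by apply/eqP; rewrite -addr_eq0 -compDl addNr comp0m. Qed.

Lemma compmN (A B D : T) (g : hom B D) (f : hom A B) : g ∘ (- f) = - (g ∘ f).
Proof. by apply/eqP; rewrite -addr_eq0 -compDr addNr compm0. Qed.

Lemma factors0 (A B : T) : factors_through w (0 : hom A B).
Proof.
by exists zero_obj; split; [apply: sub_zero|exists 0, 0; rewrite comp0m].
Qed.

Lemma factorsN (A B : T) (f : hom A B) :
  factors_through w f -> factors_through w (- f).
Proof.
by move=> [W [wW [a [b ->]]]]; exists W; split=> //; exists a, (- b); rewrite compNm.
Qed.

Lemma factorsD (A B : T) (f g : hom A B) :
  factors_through w f -> factors_through w g -> factors_through w (f + g).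
Proof.
move=> [W [wW [a [b ->]]]] [W' [wW' [a' [b' ->]]]].
exists (W ⊕ W'); split; first exact: sub_bip.
exists (in1 ∘ a + in2 ∘ a'), (copair b b').
rewrite /copair compDl !compDr -!compmA !(compmA pr1) !(compmA pr2).
by rewrite pr1_in1 pr1_in2 pr2_in1 pr2_in2 !comp0m !comp1m !compm0 addr0 add0r.
Qed.

Lemma factors_comp (A B D E : T) (f : hom A B) (g : hom B D) (h : hom D E) :
  factors_through w g -> factors_through w (h ∘ g ∘ f).
Proof.
move=> [W [wW [a [b ->]]]]; exists W; split=> //.
by exists (a ∘ f), (h ∘ b); rewrite !compmA.
Qed.

Program Definition sub_quot_congruence : congruence (full_subcategory X) :=
  @Congruence _ sub_quot_rel _ _ _ _.
Next Obligation. by move=> A B f; rewrite /sub_quot_rel subrr; apply: factors0. Qed.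
Next Obligation.
by move=> A B f g /factorsN; rewrite /sub_quot_rel opprB.
Qed.
Next Obligation.
move=> A B f g h fg gh; rewrite /sub_quot_rel -(subrKA (g : hom (sval A) (sval B))).
exact: factorsD.
Qed.
Next Obligation.
move=> A B D f f' g g' ff gg; rewrite /sub_quot_rel /=.
rewrite -(subrKA ((g : hom (sval B) (sval D)) ∘ (f' : hom (sval A) (sval B)))).
apply: factorsD.
- have := factors_comp (idm _) g ff.
  by rewrite compm1 compDr compmN.
- have := factors_comp f' (idm _) gg.
  by rewrite comp1m compDl compNm.
Qed.

Definition additive_quotient : category := quotient_category sub_quot_congruence.
End AdditiveQuotient.

(** ** Triangulated categories *)

(* The suspension Σ = [1] is an additive autoequivalence with quasi-inverse
   Ω = [-1]. The isomorphisms X ≅ X[-1][1] and X[1][-1] ≅ X are chosen so as to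
   form an adjoint equivalence; this is always possible, and without it the
   desuspension of a distinguished triangle need not be distinguished. *)
Record suspended_category := SuspendedCategory {
  susp_cat :> additive_category;
  susp : functor susp_cat susp_cat;
  desusp : functor susp_cat susp_cat;
  suspD : forall (A B : susp_cat) (f g : hom A B),
    susp @@ (f + g) = susp @@ f + susp @@ g;
  susp_unit : forall A, hom A (susp (desusp A));
  susp_counit : forall A, hom (desusp (susp A)) A;
  susp_unit_iso : forall A, is_iso (susp_unit A);
  susp_counit_iso : forall A, is_iso (susp_counit A);
  susp_unit_nat : forall (A B : susp_cat) (f : hom A B),
    susp_unit B ∘ f = (susp @@ desusp @@ f) ∘ susp_unit A;
  susp_counit_nat : forall (A B : susp_cat) (f : hom A B),
    susp_counit B ∘ (desusp @@ susp @@ f) = f ∘ susp_counit A;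
  susp_triangle : forall A,
    (susp @@ susp_counit A) ∘ susp_unit (susp A) = idm (susp A);
  desusp_triangle : forall A,
    susp_counit (desusp A) ∘ (desusp @@ susp_unit A) = idm (desusp A) }.

Notation "'Σ'" := (susp _).
Notation "'Ω'" := (desusp _).

Record triangle (T : suspended_category) := Triangle {
  tX : T; tY : T; tZ : T;
  tu : hom tX tY;
  tv : hom tY tZ;
  tw : hom tZ (Σ tX) }.

Section Triangles.
Variable T : suspended_category.

Definition triangle_iso (s t : triangle T) : Prop :=
  exists (a : hom (tX s) (tX t)) (b : hom (tY s) (tY t)) (c : hom (tZ s) (tZ t)),
    [/\ is_iso a, is_iso b & is_iso c] /\
    [/\ b ∘ tu s = tu t ∘ a, c ∘ tv s = tv t ∘ b
      & (Σ @@ a) ∘ tw s = tw t ∘ c].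

Definition zero_triangle : triangle T :=
  @Triangle T zero_obj zero_obj zero_obj 0 0 0.

Definition triangle_sum (s t : triangle T) : triangle T :=
  Triangle (bip_map (tu s) (tu t)) (bip_map (tv s) (tv t))
    ((Σ @@ in1) ∘ tw s ∘ pr1 + (Σ @@ in2) ∘ tw t ∘ pr2).

Definition triangle_susp (t : triangle T) : triangle T :=
  Triangle (- (Σ @@ tu t)) (- (Σ @@ tv t)) (- (Σ @@ tw t)).

(* X[1][-1] is identified with X[-1][1] through X. *)
Definition triangle_desusp (t : triangle T) : triangle T :=
  Triangle (- (Ω @@ tu t)) (- (Ω @@ tv t))
    (- (susp_unit (tX t) ∘ susp_counit (tX t) ∘ (Ω @@ tw t))).

(* The triangle X[i] -> Y[i] -> Z[i] -> X[i+1], with signs (-1)^i. *)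
Definition triangle_shift (i : int) (t : triangle T) : triangle T :=
  match i with
  | Posz n => iter n triangle_susp t
  | Negz n => iter n.+1 triangle_desusp t
  end.
End Triangles.

Record triangulated_category := TriangulatedCategory {
  tri_cat :> suspended_category;
  dist : triangle tri_cat -> Prop;
  dist_iso : forall s t, triangle_iso s t -> dist s -> dist t;
  dist_id : forall A : tri_cat,
    dist (@Triangle tri_cat A A zero_obj (idm A) 0 0);
  dist_complete : forall (A B : tri_cat) (u : hom A B),
    exists (D : tri_cat) (v : hom B D) (w : hom D (Σ A)),
      dist (Triangle u v w);
  dist_rotate : forall (A B D : tri_cat)
      (u : hom A B) (v : hom B D) (w : hom D (Σ A)),
    dist (Triangle u v w) <-> dist (Triangle v w (- (Σ @@ u)));
  dist_fill : forall (s t : triangle tri_cat)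
      (a : hom (tX s) (tX t)) (b : hom (tY s) (tY t)),
    dist s -> dist t -> b ∘ tu s = tu t ∘ a ->
    exists c : hom (tZ s) (tZ t),
      c ∘ tv s = tv t ∘ b /\ (Σ @@ a) ∘ tw s = tw t ∘ c;
  dist_octahedron : forall (A B D E F G : tri_cat)
      (f : hom A B) (g : hom B D)
      (i : hom B E) (i' : hom E (Σ A))
      (j : hom D F) (j' : hom F (Σ B))
      (k : hom D G) (k' : hom G (Σ A)),
    dist (Triangle f i i') -> dist (Triangle g j j') ->
    dist (Triangle (g ∘ f) k k') ->
    exists (m : hom E G) (n : hom G F),
      dist (Triangle m n ((Σ @@ i) ∘ j')) /\
      [/\ m ∘ i = k ∘ g, k' ∘ m = i', n ∘ k = j & (Σ @@ f) ∘ k' = j' ∘ n] }.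

(** ** Proper classes of triangles *)

Record proper_class (T : triangulated_category) (xi : triangle T -> Prop) :
    Prop := ProperClass {
  xi_dist : forall t, xi t -> dist t;
  xi_splitting : forall t, dist t -> tw t = 0 -> xi t;
  xi_iso : forall s t, triangle_iso s t -> xi s -> xi t;
  xi_zero : xi (zero_triangle T);
  xi_sum : forall s t, xi s -> xi t -> xi (triangle_sum s t);
  xi_shift : forall (i : int) t, xi t -> xi (triangle_shift i t);
  xi_base_change : forall (X Y Z Y' Z' : T)
      (u : hom X Y) (v : hom Y Z) (w : hom Z (Σ X)) (a : hom Z' Z)
      (u' : hom X Y') (v' : hom Y' Z'),
    xi (Triangle u v w) -> dist (Triangle u' v' (w ∘ a)) ->
    xi (Triangle u' v' (w ∘ a));
  xi_cobase_change : forall (X Y Z X' Y' : T)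
      (u : hom X Y) (v : hom Y Z) (w : hom Z (Σ X)) (b : hom X X')
      (u' : hom X' Y') (v' : hom Y' Z),
    xi (Triangle u v w) -> dist (Triangle u' v' ((Σ @@ b) ∘ w)) ->
    xi (Triangle u' v' ((Σ @@ b) ∘ w));
  xi_saturated : forall (X Y Z X' Y' Z' : T)
      (u : hom X Y) (v : hom Y Z) (w : hom Z (Σ X))
      (c : hom X' Z') (a : hom Z' Z) (d : hom Z (Σ X'))
      (u' : hom X Y') (v' : hom Y' Z'),
    dist (Triangle u v w) -> xi (Triangle c a d) ->
    xi (Triangle u' v' (w ∘ a)) -> xi (Triangle u v w) }.

Section ProperNotions.
Variables (T : triangulated_category) (xi : triangle T -> Prop).

Definition is_hocokernel (A B : T) (u : hom A B) (D : T) : Prop :=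
  exists (v : hom B D) (w : hom D (Σ A)), dist (Triangle u v w).

Definition is_hokernel (A B : T) (u : hom A B) (K : T) : Prop :=
  exists (k : hom K A) (w : hom B (Σ K)), dist (Triangle k u w).

Definition proper_mono (A B : T) (u : hom A B) : Prop :=
  exists (D : T) (v : hom B D) (w : hom D (Σ A)), xi (Triangle u v w).

(* A triangle D[-1] -> A -> B -> D, with D identified with D[-1][1]. *)
Definition proper_epi (A B : T) (u : hom A B) : Prop :=
  exists (D : T) (k : hom (Ω D) A) (v : hom B D),
    xi (Triangle k u (susp_unit D ∘ v)).

Definition splitting_mono (A B : T) (u : hom A B) : Prop :=
  exists r : hom B A, r ∘ u = idm A.

(** ** Extensions and cotorsion pairs *)

(* Triangles B -> E -> A -> B[1] in xi: the elements of Ext_xi(A, B) are their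
   classes for [ext_equiv]. *)
Record extension (A B : T) := Extension {
  ext_mid : T;
  ext_u : hom B ext_mid;
  ext_v : hom ext_mid A;
  ext_w : hom A (Σ B);
  ext_xi : xi (Triangle ext_u ext_v ext_w) }.

Definition ext_equiv (A B : T) (e e' : extension A B) : Prop :=
  exists h : hom (ext_mid e) (ext_mid e'),
    [/\ h ∘ ext_u e = ext_u e', ext_v e' ∘ h = ext_v e & ext_w e' = ext_w e].

Definition ext_splitting (A B : T) (e : extension A B) : Prop := ext_w e = 0.

(* Ext_xi(A, B) = 0: every class is that of the splitting triangle. *)
Definition ext_vanishes (A B : T) : Prop :=
  forall e : extension A B, exists e0 : extension A B,
    ext_splitting e0 /\ ext_equiv e e0.

Definition cotorsion_pair (X Y : T -> Prop) : Prop :=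
  (forall B, Y B <-> (forall A, X A -> ext_vanishes A B)) /\
  (forall A, X A <-> (forall B, Y B -> ext_vanishes A B)).

Definition complete_pair (X Y : T -> Prop) : Prop :=
  forall A : T,
    (exists (B C : T) (u : hom B C) (v : hom C A) (w : hom A (Σ B)),
      [/\ Y B, X C & xi (Triangle u v w)]) /\
    (exists (B C : T) (u : hom A B) (v : hom B C) (w : hom C (Σ A)),
      [/\ Y B, X C & xi (Triangle u v w)]).

Definition hereditary_pair (X Y : T -> Prop) : Prop :=
  (forall (K X1 X2 : T) (u : hom K X1) (v : hom X1 X2) (w : hom X2 (Σ K)),
    xi (Triangle u v w) -> X X1 -> X X2 -> X K) /\
  (forall (Y1 Y2 C : T) (u : hom Y1 Y2) (v : hom Y2 C) (w : hom C (Σ Y1)),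
    xi (Triangle u v w) -> Y Y1 -> Y Y2 -> Y C).

Definition hereditary_complete_cotorsion_pair (X Y : T -> Prop) : Prop :=
  [/\ cotorsion_pair X Y, complete_pair X Y & hereditary_pair X Y].

(** ** The three classes of morphisms *)

Definition CoFib (X : T -> Prop) : mor_class T := fun A B f =>
  proper_mono f /\ exists D, is_hocokernel f D /\ X D.

Definition Fib (w : T -> Prop) : mor_class T := fun A B f =>
  forall W : T, w W -> forall g : hom W B, exists h : hom W A, f ∘ h = g.

Definition Weq (w Y : T -> Prop) : mor_class T := fun A B f =>
  exists (W : T) (t : hom W B),
    [/\ w W, proper_epi (copair f t)
      & exists K, is_hokernel (copair f t) K /\ Y K].
End ProperNotions.

Definition contravariantly_finite (C : category) (w : C -> Prop) : Prop :=
  forall A : C, exists (W : C) (f : hom W A), w W /\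
    forall (W' : C) (g : hom W' A), w W' -> exists h : hom W' W, f ∘ h = g.

Section ModelObjects.
Variables (C : additive_category) (M : mor_class C).

(* [M] is the class of cofibrations, fibrations, weak equivalences resp. *)
Definition cofibrant (A : C) : Prop := M (0 : hom zero_obj A).
Definition fibrant (A : C) : Prop := M (0 : hom A zero_obj).
Definition trivial_obj (A : C) : Prop := M (0 : hom zero_obj A).
End ModelObjects.

(* Main.v *)
From mathcomp Require Import all_boot ssralg boolp.
Require Import Defs.

Set Implicit Arguments.
Unset Strict Implicit.
Unset Printing Implicit Defensive.

Import GRing.Theory.
Local Open Scope ring_scope.

(** Call the connecting maps of the triangles in [xi] phantom: they form an ideal,
    and saturation lets one cancel [xi]-proper epimorphisms on the right and
    [xi]-proper monomorphisms on the left.  In a model structure every object is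
    fibrant and [B -> 0] is a trivial fibration for [B] in [Y]; lifting against it
    gives [Ext_xi(X, Y) = 0], and factoring [0 -> A] and [A -> 0] gives
    completeness.  Conversely, a hereditary complete cotorsion pair provides each
    [A] with an essentially unique replacement [QA -> A], a [xi]-proper epimorphism
    with [QA] in [X] and hokernel in [Y], whence a functor [Q] from [T] to
    [X / omega].  The weak equivalences are exactly the maps inverted by [Q], which
    yields two-out-of-three, closure under retracts and the equivalence between the
    homotopy category and [X / omega]. *)

(** * Isomorphisms in a category and their images under functors *)

Section Isomorphisms.
Variable C : category.

Lemma iso_id (A : C) : is_iso (idm A).
Proof. by exists (idm A); rewrite comp1m. Qed.

Lemma iso_comp (A B D : C) (f : hom A B) (g : hom B D) :
  is_iso f -> is_iso g -> is_iso (g ∘ f).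
Proof.
move=> [f' [ff' f'f]] [g' [gg' g'g]]; exists (f' ∘ g'); split.
- by rewrite compmA -(compmA f') gg' compm1.
- by rewrite compmA -(compmA g) f'f compm1.
Qed.

Lemma iso_inv (A B : C) (f : hom A B) (g : hom B A) :
  g ∘ f = idm A -> f ∘ g = idm B -> is_iso g.
Proof. by exists f. Qed.

Lemma iso_cancel_r (A B D : C) (f : hom A B) (g : hom B D) :
  is_iso f -> is_iso (g ∘ f) -> is_iso g.
Proof.
move=> [f' [ff' f'f]] gf; have -> : g = g ∘ f ∘ f' by rewrite -compmA f'f compm1.
by apply: iso_comp gf; apply: iso_inv ff' f'f.
Qed.

Lemma iso_cancel_l (A B D : C) (f : hom A B) (g : hom B D) :
  is_iso g -> is_iso (g ∘ f) -> is_iso f.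
Proof.
move=> [g' [gg' g'g]] gf; have -> : f = g' ∘ (g ∘ f) by rewrite compmA gg' comp1m.
by apply: iso_comp gf _; apply: iso_inv gg' g'g.
Qed.

Lemma iso_mono (A B D : C) (g : hom B D) (f f' : hom A B) :
  is_iso g -> g ∘ f = g ∘ f' -> f = f'.
Proof.
by move=> [h [hg gh]] e; rewrite -(comp1m f) -hg -compmA e compmA hg comp1m.
Qed.

Lemma iso_epi (A B D : C) (f : hom A B) (g g' : hom B D) :
  is_iso f -> g ∘ f = g' ∘ f -> g = g'.
Proof.
by move=> [h [hf fh]] e; rewrite -(compm1 g) -fh compmA e -compmA fh compm1.
Qed.

Lemma iso_retract (A B A' B' : C) (f : hom A B) (g : hom A' B') :
  is_retract f g -> is_iso g -> is_iso f.
Proof.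
move=> [i [r [j [q [ri qj gi fr]]]]] [h [hg gh]].
exists (r ∘ h ∘ j); split.
- by rewrite -!compmA -gi (compmA h) hg comp1m.
- by rewrite !compmA fr -(compmA q) gh compm1.
Qed.

End Isomorphisms.

Section Functors.
Variables (C D : category) (F : functor C D).

Lemma fmor_iso (A B : C) (f : hom A B) : is_iso f -> is_iso (F @@ f).
Proof. by move=> [g [gf fg]]; exists (F @@ g); rewrite -!fmorM gf fg !fmor1. Qed.

Lemma fmor_retract (A B A' B' : C) (f : hom A B) (g : hom A' B') :
  is_retract f g -> is_retract (F @@ f) (F @@ g).
Proof.
move=> [i [r [j [q [ri qj gi fr]]]]].
by exists (F @@ i), (F @@ r), (F @@ j), (F @@ q); rewrite -!fmorM ri qj gi fr !fmor1.
Qed.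

End Functors.

(** * Matrix calculus for biproducts *)

Section Additive.
Variable T : additive_category.
Implicit Types A B D : T.

Lemma compBl A B D (g g' : hom B D) (f : hom A B) :
  (g - g') ∘ f = g ∘ f - g' ∘ f.
Proof. by rewrite compDl compNm. Qed.

Lemma compBr A B D (g : hom B D) (f f' : hom A B) :
  g ∘ (f - f') = g ∘ f - g ∘ f'.
Proof. by rewrite compDr compmN. Qed.

Lemma copair_in1 A B D (f : hom A D) (t : hom B D) : copair f t ∘ in1 = f.
Proof.
by rewrite /copair compDl -!compmA pr1_in1 pr2_in1 compm1 compm0 addr0.
Qed.

Lemma copair_in2 A B D (f : hom A D) (t : hom B D) : copair f t ∘ in2 = t.
Proof.
by rewrite /copair compDl -!compmA pr1_in2 pr2_in2 compm1 compm0 add0r.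
Qed.

Definition bpair A B D (f : hom D A) (g : hom D B) : hom D (A ⊕ B) :=
  in1 ∘ f + in2 ∘ g.

Lemma pr1_bpair A B D (f : hom D A) (g : hom D B) : pr1 ∘ bpair f g = f.
Proof. by rewrite /bpair compDr !compmA pr1_in1 pr1_in2 comp1m comp0m addr0. Qed.

Lemma pr2_bpair A B D (f : hom D A) (g : hom D B) : pr2 ∘ bpair f g = g.
Proof. by rewrite /bpair compDr !compmA pr2_in1 pr2_in2 comp1m comp0m add0r. Qed.

Lemma copair_bpair A B D E (f : hom A D) (t : hom B D) (x : hom E A) (y : hom E B) :
  copair f t ∘ bpair x y = f ∘ x + t ∘ y.
Proof. by rewrite /copair compDl -!compmA pr1_bpair pr2_bpair. Qed.

Lemma comp_copair A B D E (g : hom D E) (f : hom A D) (t : hom B D) :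
  g ∘ copair f t = copair (g ∘ f) (g ∘ t).
Proof. by rewrite /copair compDr !compmA. Qed.

Lemma copair_eta A B D (f : hom (A ⊕ B) D) : f = copair (f ∘ in1) (f ∘ in2).
Proof. by rewrite -comp_copair /copair bip_id compm1. Qed.

Lemma bpair_eta A B D (f : hom D (A ⊕ B)) : f = bpair (pr1 ∘ f) (pr2 ∘ f).
Proof. by rewrite /bpair !compmA -compDl bip_id comp1m. Qed.

Lemma pr1_zero_iso A : is_iso (pr1 : hom (A ⊕ zero_obj) A).
Proof.
exists in1; rewrite pr1_in1; split=> //.
by rewrite -[RHS]bip_id [X in _ + in2 ∘ X]to_zero_obj compm0 addr0.
Qed.

Lemma pr2_zero_iso A : is_iso (pr2 : hom (zero_obj ⊕ A) A).
Proof.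
exists in2; rewrite pr2_in2; split=> //.
by rewrite -[RHS]bip_id [X in in1 ∘ X]to_zero_obj compm0 add0r.
Qed.

Lemma unipotent_iso A (c : hom A A) :
  (c - idm A) ∘ (c - idm A) = 0 -> is_iso c.
Proof.
have -> : c = idm A + (c - idm A) by rewrite addrC subrK.
rewrite addrAC subrr add0r; move: (c - idm A) => n n2.
exists (idm A - n); split.
- by rewrite compBl !compDr n2 !compm1 comp1m addr0 addrK.
- by rewrite compDl !compBr n2 !compm1 comp1m subr0 subrK.
Qed.

End Additive.

(** * The suspension is additive and fully faithful *)

Section Suspension.
Variable T : suspended_category.
Implicit Types A B D : T.

Lemma susp0 A B : Σ @@ (0 : hom A B) = 0.
Proof. by apply: (addrI (Σ @@ 0)); rewrite -suspD !addr0. Qed.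

Lemma suspN A B (f : hom A B) : Σ @@ (- f) = - (Σ @@ f).
Proof. by apply/eqP; rewrite -addr_eq0 -suspD addNr susp0. Qed.

Lemma suspB A B (f g : hom A B) : Σ @@ (f - g) = Σ @@ f - Σ @@ g.
Proof. by rewrite suspD suspN. Qed.

Lemma susp_faithful A B (f g : hom A B) : Σ @@ f = Σ @@ g -> f = g.
Proof.
move=> fg; apply: (iso_epi (susp_counit_iso A)).
by rewrite -!susp_counit_nat fg.
Qed.

Lemma susp_counitK A :
  susp_unit (Σ A) ∘ (Σ @@ susp_counit A) = idm (Σ (Ω (Σ A))).
Proof.
apply: (iso_mono (fmor_iso (susp T) (susp_counit_iso A))).
by rewrite compmA susp_triangle comp1m compm1.
Qed.

(** Desuspend [f] and conjugate by the counit; the triangle identity turns the suspension of the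
    result back into [f]. *)
Lemma susp_full A B (f : hom (Σ A) (Σ B)) : exists g : hom A B, Σ @@ g = f.
Proof.
have [e [ce ec]] := susp_counit_iso A.
exists (susp_counit B ∘ (Ω @@ f) ∘ e); rewrite !fmorM.
apply: (iso_mono (susp_unit_iso (Σ B))).
rewrite !compmA susp_counitK comp1m susp_unit_nat -[RHS]compm1.
rewrite -(fmor1 (susp T) A) -ec fmorM !compmA; congr (_ ∘ _).
by rewrite -!compmA -[LHS]compm1; congr (_ ∘ _); rewrite susp_counitK.
Qed.

Lemma susp_zero A (f : hom A (Σ zero_obj)) : f = 0.
Proof.
rewrite -(comp1m f) -fmor1.
by rewrite (to_zero_obj (idm zero_obj)) susp0 comp0m.
Qed.

End Suspension.

(** * Exactness, splitting and comparison of distinguished triangles *)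

Section TriangleBasics.
Variable T : triangulated_category.
Implicit Types A B D E K : T.

Lemma iso_opp A : is_iso (- idm A).
Proof. by exists (- idm A); rewrite compNm compmN opprK comp1m. Qed.

Lemma dist_sign12 A B D (u : hom A B) (v : hom B D) (w : hom D (Σ A)) :
  dist (Triangle u v w) -> dist (Triangle (- u) (- v) w).
Proof.
apply: dist_iso; exists (idm A), (- idm B), (idm D); split.
  by split; [exact: iso_id|exact: iso_opp|exact: iso_id].
by rewrite /= fmor1 !(compNm, compmN) ?opprK !comp1m !compm1.
Qed.

(** Three rotations put a minus sign on each map; the automorphism [-1] of the middle object removes
    the first two. *)
Lemma dist_susp A B D (u : hom A B) (v : hom B D) (w : hom D (Σ A)) :
  dist (Triangle u v w) <-> dist (Triangle (Σ @@ u) (Σ @@ v) (- (Σ @@ w))).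
Proof.
rewrite dist_rotate dist_rotate dist_rotate.
split=> [/dist_sign12|/dist_sign12]; by rewrite ?opprK.
Qed.

(** The cone [D] is replaced by the suspension of its desuspension, so that the triangle rotates
    back; the sign of [k] absorbs that of the rotation. *)
Lemma dist_cocone A B (f : hom A B) :
  exists K (k : hom K A) (w : hom B (Σ K)), dist (Triangle k f w).
Proof.
have [D [p [q d]]] := dist_complete f.
have [e [eu ue]] := susp_unit_iso D.
have [k kE] := susp_full (q ∘ e).
exists (Ω D), (- k), (susp_unit D ∘ p); apply/dist_rotate.
apply: dist_iso d; exists (idm A), (idm B), (susp_unit D); split.
  by split; [exact: iso_id|exact: iso_id|exact: susp_unit_iso].
by rewrite /= suspN opprK kE fmor1 -(compmA q) eu !comp1m !compm1.
Qed.

Lemma dist_cocone2 A B (w : hom B (Σ A)) :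
  exists E (u : hom A E) (v : hom E B), dist (Triangle u v w).
Proof.
have [E [v [q d]]] := dist_cocone w.
have [u uE] := susp_full q.
by exists E, (- u), v; apply/dist_rotate; rewrite suspN opprK uE.
Qed.

Lemma dist_fill3 A B D A' B' D' (u : hom A B) (v : hom B D) (w : hom D (Σ A))
    (u' : hom A' B') (v' : hom B' D') (w' : hom D' (Σ A'))
    (a : hom A A') (b : hom B B') :
  dist (Triangle u v w) -> dist (Triangle u' v' w') -> b ∘ u = u' ∘ a ->
  exists c : hom D D', c ∘ v = v' ∘ b /\ (Σ @@ a) ∘ w = w' ∘ c.
Proof. exact: (@dist_fill T (Triangle u v w) (Triangle u' v' w') a b). Qed.

Section Exactness.
Variables (A B D : T) (u : hom A B) (v : hom B D) (w : hom D (Σ A)).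
Hypothesis d : dist (Triangle u v w).

Lemma dist_vu : v ∘ u = 0.
Proof.
have [|c [+ _]] := dist_fill3 (a := idm A) (b := u) (dist_id A) d; first by [].
by rewrite compm0 => <-.
Qed.

(** The pair [(f, 0)] extends to a morphism from the rotated identity triangle of [E] to the rotated
    given one; its third component is the suspension of the wanted factor. *)
Lemma dist_lift E (f : hom E B) : v ∘ f = 0 -> exists g, f = u ∘ g.
Proof.
move=> vf; have /dist_rotate d1 := dist_id E; have /dist_rotate d2 := d.
have [|c [_]] := dist_fill3 (a := f) (b := 0) d1 d2; first by rewrite compm0.
rewrite fmor1 compmN compm1 compNm => /oppr_inj.
have [g <-] := susp_full c; rewrite -fmorM => /susp_faithful ->.
by exists g.
Qed.

Lemma dist_extend E (f : hom B E) : f ∘ u = 0 -> exists g, f = g ∘ v.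
Proof.
move=> fu.
have d1 : dist (@Triangle T zero_obj E E 0 (idm E) 0).
  apply/dist_rotate; rewrite susp0 oppr0; apply: dist_iso (dist_id E).
  exists (idm E), (idm E), 0; split; last by rewrite /= fmor1 !comp0m !compm0.
  split; [exact: iso_id|exact: iso_id|exists 0].
  by split; [rewrite [RHS]to_zero_obj comp0m|rewrite [RHS]susp_zero comp0m].
have [|c [+ _]] := dist_fill3 (a := 0) (b := f) d d1; first by rewrite compm0.
by rewrite comp1m => <-; exists c.
Qed.

End Exactness.

Section Exactness2.
Variables (A B D : T) (u : hom A B) (v : hom B D) (w : hom D (Σ A)).
Hypothesis d : dist (Triangle u v w).

Lemma dist_wv : w ∘ v = 0.
Proof. by move/dist_rotate: d => /dist_vu. Qed.

Lemma dist_uw : (Σ @@ u) ∘ w = 0.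
Proof.
by move/dist_rotate/dist_rotate: d => /dist_vu /eqP; rewrite compNm oppr_eq0 => /eqP.
Qed.

Lemma dist_lift3 E (f : hom E D) : w ∘ f = 0 -> exists g, f = v ∘ g.
Proof. by move/dist_rotate: d => /dist_lift; apply. Qed.

Lemma dist_extend3 E (f : hom D E) : f ∘ v = 0 -> exists g, f = g ∘ w.
Proof. by move/dist_rotate: d => /dist_extend; apply. Qed.

Lemma dist_lift1 E (f : hom E (Σ A)) : (Σ @@ u) ∘ f = 0 -> exists g, f = w ∘ g.
Proof.
move=> uf; move/dist_rotate/dist_rotate: d => /dist_lift; apply.
by rewrite compNm uf oppr0.
Qed.

Lemma dist_extend1 E (s : hom A E) : (Σ @@ s) ∘ w = 0 -> exists g, s = g ∘ u.
Proof.
move=> sw; move/dist_rotate/dist_rotate: d => /dist_extend/(_ _ _ sw) [h].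
have [g <-] := susp_full h; rewrite compmN -compNm -suspN -fmorM.
by move/susp_faithful => ->; exists (- g).
Qed.

(* [c - 1] factors through [w] and is killed by it, hence squares to zero. *)
Lemma dist_endo_iso (c : hom D D) : c ∘ v = v -> w ∘ c = w -> is_iso c.
Proof.
move=> cv wc; apply: unipotent_iso.
have [|s es] := dist_extend3 (f := c - idm D); first by rewrite compBl cv comp1m subrr.
by rewrite {1}es -compmA compBr wc compm1 subrr compm0.
Qed.

Lemma dist_endo_iso1 (c : hom A A) : u ∘ c = u -> (Σ @@ c) ∘ w = w -> is_iso c.
Proof.
move=> uc cw; apply: unipotent_iso.
have [|s es] := dist_extend1 (s := c - idm A).
  by rewrite suspB fmor1 compBl cw comp1m subrr.
by rewrite {1}es -compmA compBr uc compm1 subrr compm0.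
Qed.

End Exactness2.

Lemma dist_fill1 A B D A' B' D' (u : hom A B) (v : hom B D) (w : hom D (Σ A))
    (u' : hom A' B') (v' : hom B' D') (w' : hom D' (Σ A'))
    (b : hom B B') (c : hom D D') :
  dist (Triangle u v w) -> dist (Triangle u' v' w') -> c ∘ v = v' ∘ b ->
  exists a : hom A A', b ∘ u = u' ∘ a /\ (Σ @@ a) ∘ w = w' ∘ c.
Proof.
move=> /dist_rotate d /dist_rotate d' e.
have [x] := dist_fill3 (a := b) (b := c) d d' e.
have [a <-] := susp_full x; rewrite compmN compNm => -[aw /oppr_inj].
by rewrite -!fmorM => /susp_faithful bu; exists a.
Qed.

Definition retract_of A B := exists (i : hom A B) (r : hom B A), r ∘ i = idm A.

Lemma split_mono_w A B D (u : hom A B) (v : hom B D) (w : hom D (Σ A)) :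
  dist (Triangle u v w) -> splitting_mono u -> w = 0.
Proof.
move=> d [r ru]; rewrite -(comp1m w) -fmor1 -ru fmorM -compmA (dist_uw d).
exact: compm0.
Qed.

Lemma split_epi_w A B D (u : hom A B) (v : hom B D) (w : hom D (Σ A))
    (s : hom D B) :
  dist (Triangle u v w) -> v ∘ s = idm D -> w = 0.
Proof. by move=> d vs; rewrite -(compm1 w) -vs compmA (dist_wv d) comp0m. Qed.

(** [1 - u ∘ r] vanishes on [u], so it equals [s ∘ v]; since [w = 0], the identity of [D] factors
    through [v], so [v] can be cancelled on the right. *)
Lemma split_mono_dec A B D (u : hom A B) (v : hom B D) (w : hom D (Σ A))
    (r : hom B A) :
  dist (Triangle u v w) -> r ∘ u = idm A ->
  exists s : hom D B, [/\ v ∘ s = idm D, r ∘ s = 0 & u ∘ r + s ∘ v = idm B].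
Proof.
move=> d ru.
have [|s es] := dist_extend d (f := idm B - u ∘ r).
  by rewrite compBl comp1m -compmA ru compm1 subrr.
have w0 : w = 0 by apply: split_mono_w d _; exists r.
have [|s' es'] := dist_lift3 d (f := idm D); first by rewrite w0 comp0m.
have vsv : v ∘ s ∘ v = v.
  by rewrite -compmA -es compBr compmA (dist_vu d) comp0m subr0 compm1.
have vs : v ∘ s = idm D.
  by rewrite -(compm1 (v ∘ s)) es' compmA vsv.
exists s; split=> //; last by rewrite -es addrC subrK.
rewrite -(compm1 (r ∘ s)) es' compmA -(compmA r) -es compBr compmA ru.
by rewrite compm1 comp1m subrr comp0m.
Qed.

Lemma split_mono_iso A B D (u : hom A B) (v : hom B D) (w : hom D (Σ A)) :
  dist (Triangle u v w) -> splitting_mono u ->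
  exists s : hom D B, is_iso (copair u s) /\ v ∘ s = idm D.
Proof.
move=> d [r ru]; have [s [vs rs e]] := split_mono_dec d ru.
exists s; split=> //; exists (bpair r v); split; last by rewrite copair_bpair.
by rewrite [LHS]copair_eta -compmA copair_in1 -compmA copair_in2 [RHS]copair_eta
  !comp1m /bpair !compDl -!compmA ru vs rs (dist_vu d) !compm0 !compm1 addr0 add0r.
Qed.

Lemma dist_in1 A B : dist (@Triangle T A (A ⊕ B) B in1 pr2 0).
Proof.
have [D [v [w d]]] := dist_complete (in1 : hom A (A ⊕ B)).
have [s [vs _ _]] := split_mono_dec d (pr1_in1 A B).
have [c cE] := dist_extend d (pr2_in1 A B).
apply: (dist_iso _ d); exists (idm A), (idm _), c; split; last first.
  rewrite /= fmor1 !comp1m !compm1 comp0m -cE; split=> //.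
  by apply: (split_mono_w d); exists pr1; apply: pr1_in1.
split; [exact: iso_id|exact: iso_id|exists (v ∘ in2)].
split; last by rewrite compmA -cE pr2_in2.
rewrite -[LHS]compm1 -vs -!compmA (compmA c) -cE (compmA in2) (compmA v).
have -> : in2 ∘ pr2 = idm (A ⊕ B) - in1 ∘ pr1 by rewrite -bip_id addrC addKr.
by rewrite compBr compm1 compmA (dist_vu d) comp0m subr0.
Qed.

(** The section [i] splits off its cone, making [A] a direct summand of [B]. *)
Lemma sub_retract (X : additive_subcategory T) A B : retract_of A B -> X B -> X A.
Proof.
move=> [i [r ri]] XB; have [D [v [w d]]] := dist_complete i.
have [|s [ci _]] := split_mono_iso d; first by exists r.
suff /sub_summand[] : X (A ⊕ D) by [].
by apply: sub_iso XB; move: ci => [g [gc cg]]; exists g, (copair i s).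
Qed.

Lemma retract_iso A B (c : hom A B) (c' : hom B A) :
  is_iso (c' ∘ c) -> retract_of A B.
Proof. by move=> [g [gc _]]; exists c, (g ∘ c'); rewrite -compmA. Qed.

(** Filling is not functorial, so the induced maps of cones need not compose to the identity; but
    the composite fixes [v] and [w], hence is invertible, which suffices for a retract. *)
Lemma cone_retract A B D A' B' D' (u : hom A B) (v : hom B D) (w : hom D (Σ A))
    (u' : hom A' B') (v' : hom B' D') (w' : hom D' (Σ A'))
    (a : hom A A') (b : hom B B') (a' : hom A' A) (b' : hom B' B) :
  dist (Triangle u v w) -> dist (Triangle u' v' w') ->
  b ∘ u = u' ∘ a -> b' ∘ u' = u ∘ a' -> a' ∘ a = idm A -> b' ∘ b = idm B ->
  retract_of D D'.
Proof.
move=> d d' e e' aa bb.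
have [c [cv cw]] := dist_fill3 (a := a) (b := b) d d' e.
have [c' [cv' cw']] := dist_fill3 (a := a') (b := b') d' d e'.
apply: (retract_iso (c := c) (c' := c')); apply: (dist_endo_iso d).
- by rewrite -compmA cv compmA cv' -compmA bb compm1.
- by rewrite compmA -cw' -compmA -cw compmA -fmorM aa fmor1 comp1m.
Qed.

Lemma cocone_retract A B D A' B' D' (u : hom A B) (v : hom B D) (w : hom D (Σ A))
    (u' : hom A' B') (v' : hom B' D') (w' : hom D' (Σ A'))
    (b : hom B B') (c : hom D D') (b' : hom B' B) (c' : hom D' D) :
  dist (Triangle u v w) -> dist (Triangle u' v' w') ->
  c ∘ v = v' ∘ b -> c' ∘ v' = v ∘ b' -> b' ∘ b = idm B -> c' ∘ c = idm D ->
  retract_of A A'.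
Proof.
move=> d d' e e' bb cc.
have [a [au aw]] := dist_fill1 d d' e.
have [a' [au' aw']] := dist_fill1 d' d e'.
apply: (retract_iso (c := a) (c' := a')); apply: (dist_endo_iso1 d).
- by rewrite compmA -au' -compmA -au compmA bb comp1m.
- by rewrite fmorM -compmA aw compmA aw' -compmA cc compm1.
Qed.

(** This weak uniqueness of cones suffices, as the subcategories in play are closed under direct
    summands. *)
Lemma hocokernel_retract A B (f : hom A B) D D' :
  is_hocokernel f D -> is_hocokernel f D' -> retract_of D D'.
Proof.
move=> [v [w d]] [v' [w' d']].
by apply: (cone_retract (a := idm A) (b := idm B) (a' := idm A) (b' := idm B) d d');
   rewrite ?comp1m ?compm1.
Qed.

Lemma hokernel_retract A B (f : hom A B) K K' :
  is_hokernel f K -> is_hokernel f K' -> retract_of K K'.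
Proof.
move=> [k [w d]] [k' [w' d']].
by apply: (cocone_retract (b := idm A) (c := idm B) (b' := idm A) (c' := idm B) d d');
   rewrite ?comp1m ?compm1.
Qed.

(* The octahedral axiom, desuspended so as to relate homotopy kernels. *)
Lemma hokernel_comp A B D K1 K2 K3 (f : hom A B) (g : hom B D)
    (k1 : hom K1 A) (w1 : hom B (Σ K1)) (k2 : hom K2 B) (w2 : hom D (Σ K2))
    (k3 : hom K3 A) (w3 : hom D (Σ K3)) :
  dist (Triangle k1 f w1) -> dist (Triangle k2 g w2) ->
  dist (Triangle k3 (g ∘ f) w3) ->
  exists (m : hom K1 K3) (n : hom K3 K2),
    [/\ dist (Triangle m n (w1 ∘ k2)), (Σ @@ n) ∘ w3 = w2 & f ∘ k3 = k2 ∘ n].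
Proof.
move=> /dist_rotate d1 /dist_rotate d2 /dist_rotate d3.
have [m' [n' []]] := dist_octahedron d1 d2 d3.
have [m <-] := susp_full m'; have [n <-] := susp_full n' => d [_ _ e1 e2].
exists m, n; split=> //.
- by apply/dist_susp; rewrite fmorM -compmN.
- by apply: susp_faithful; move: e2; rewrite compmN compNm -!fmorM => /oppr_inj.
Qed.

End TriangleBasics.

(** * Phantom maps, proper monomorphisms and proper epimorphisms *)

Section ProperClass.
Variables (T : triangulated_category) (xi : triangle T -> Prop).
Hypothesis xi_proper : proper_class xi.
Implicit Types A B D E K : T.

(* [w] stands for an element of [Ext_xi B A]. *)
Definition phantom A B (w : hom B (Σ A)) : Prop :=
  exists E (u : hom A E) (v : hom E B), xi (Triangle u v w).

(** By base change along the identity, membership of a distinguished triangle in [xi] depends only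
    on its connecting map. *)
Lemma xi_phantom A B D (u : hom A B) (v : hom B D) (w : hom D (Σ A)) :
  xi (Triangle u v w) <-> dist (Triangle u v w) /\ phantom w.
Proof.
split=> [x|[d [E [u' [v' x]]]]].
  by split; [apply: xi_dist x|exists B, u, v].
have := xi_base_change xi_proper (a := idm D) (u' := u) (v' := v) x.
by rewrite compm1; apply.
Qed.

Lemma phantom_comp A B D (w : hom B (Σ A)) (f : hom D B) :
  phantom w -> phantom (w ∘ f).
Proof.
move=> [E [u [v x]]]; have [E' [u' [v' d]]] := dist_cocone2 (w ∘ f).
by exists E', u', v'; apply: xi_base_change x d.
Qed.

Lemma phantom_susp A B D (w : hom B (Σ A)) (f : hom A D) :
  phantom w -> phantom ((Σ @@ f) ∘ w).
Proof.
move=> [E [u [v x]]]; have [E' [u' [v' d]]] := dist_cocone2 ((Σ @@ f) ∘ w).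
by exists E', u', v'; apply: xi_cobase_change x d.
Qed.

Lemma phantomN A B (w : hom B (Σ A)) : phantom w -> phantom (- w).
Proof. by move=> /(phantom_comp (- idm B)); rewrite compmN compm1. Qed.

Lemma phantom0 A B : phantom (0 : hom B (Σ A)).
Proof.
have [E [u [v d]]] := dist_cocone2 (0 : hom B (Σ A)).
by exists E, u, v; apply: xi_splitting.
Qed.

Lemma phantom_saturated A B D E (w : hom B (Σ A))
    (c : hom D E) (a : hom E B) (d : hom B (Σ D)) :
  xi (Triangle c a d) -> phantom (w ∘ a) -> phantom w.
Proof.
move=> x [F [u [v y]]]; have [F' [u' [v' t]]] := dist_cocone2 w.
by exists F', u', v'; apply: xi_saturated t x y.
Qed.

(** Let [q] be a proper epimorphism with connecting map [(Σ @@ b) ∘ w]. Then [w ∘ q] is killed by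
    [Σ @@ b], so it factors through the phantom [e], and saturation cancels [q]. *)
Lemma phantom_cosaturated A B D E (w : hom B (Σ A))
    (b : hom A D) (c : hom D E) (e : hom E (Σ A)) :
  xi (Triangle b c e) -> phantom ((Σ @@ b) ∘ w) -> phantom w.
Proof.
move=> /xi_phantom[d pe] [F [u [q x]]]; apply: (phantom_saturated x).
have [|s ->] := dist_lift1 d (f := w ∘ q).
  by rewrite compmA (dist_wv (xi_dist xi_proper x)).
exact: phantom_comp.
Qed.

Definition deflation A B (f : hom A B) : Prop :=
  exists K (k : hom K A) (w : hom B (Σ K)), xi (Triangle k f w).

Lemma deflationP A B (f : hom A B) K (k : hom K A) (w : hom B (Σ K)) :
  dist (Triangle k f w) -> deflation f <-> phantom w.
Proof.
move=> d; split=> [[K' [k' [w' /xi_phantom[d' pw]]]]|pw]; last first.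
  by exists K, k, w; apply/xi_phantom.
have [|a [_]] := dist_fill1 (b := idm A) (c := idm B) d' d.
  by rewrite comp1m compm1.
by rewrite compm1 => <-; apply: phantom_susp.
Qed.

Lemma proper_monoP A B (f : hom A B) D (v : hom B D) (w : hom D (Σ A)) :
  dist (Triangle f v w) -> proper_mono xi f <-> phantom w.
Proof.
move=> d; split=> [[D' [v' [w' /xi_phantom[d' pw]]]]|pw]; last first.
  by exists D, v, w; apply/xi_phantom.
have [|c [_]] := dist_fill3 (a := idm A) (b := idm B) d d'.
  by rewrite comp1m compm1.
by rewrite fmor1 comp1m => ->; apply: phantom_comp.
Qed.

Lemma proper_epi_deflation A B (f : hom A B) : proper_epi xi f <-> deflation f.
Proof.
split=> [[D [k [v x]]]|[K [k [w x]]]]; first by exists (Ω D), k, (susp_unit D ∘ v).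
have [e [ce ec]] := susp_counit_iso K.
exists (Σ K), (k ∘ susp_counit K), w; apply: xi_iso x => //.
exists e, (idm A), (idm B); split.
  by split; [exists (susp_counit K)|exact: iso_id|exact: iso_id].
rewrite /= -!compmA ec !comp1m !compm1; split=> //.
apply: (iso_mono (fmor_iso (susp T) (susp_counit_iso K))).
by rewrite !compmA -fmorM ec fmor1 susp_triangle.
Qed.

(** With [c] the connecting map of [g ∘ f], comparison with the triangle of [f] shows that [c ∘ g]
    is phantom; saturation cancels [g]. *)
Lemma deflation_comp A B D (f : hom A B) (g : hom B D) :
  deflation f -> deflation g -> deflation (g ∘ f).
Proof.
move=> [K [k [w /xi_phantom[df pw]]]] [L [l [e xg]]].
have [M [m [c d]]] := dist_cocone (g ∘ f).
apply/(deflationP d); apply: phantom_saturated xg _.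
have [|a [_]] := dist_fill1 (b := idm A) (c := g) df d; first by rewrite compm1.
by move=> <-; apply: phantom_susp.
Qed.

Lemma deflation_cancel A B D (f : hom A B) (g : hom B D) :
  deflation (g ∘ f) -> deflation g.
Proof.
move=> [M [m [c /xi_phantom[d pc]]]].
have [L [l [e dg]]] := dist_cocone g.
apply/(deflationP dg).
have [|a [_]] := dist_fill1 (b := f) (c := idm D) d dg; first by rewrite comp1m.
by rewrite compm1 => <-; apply: phantom_susp.
Qed.

Lemma proper_mono_comp A B D (f : hom A B) (g : hom B D) :
  proper_mono xi f -> proper_mono xi g -> proper_mono xi (g ∘ f).
Proof.
move=> [F [v [w xf]]] [G [v' [w' /xi_phantom[dg pw]]]].
have [M [m [c d]]] := dist_complete (g ∘ f).
apply/(proper_monoP d); apply: phantom_cosaturated xf _.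
have [|n [_ ->]] := dist_fill3 (a := f) (b := idm D) d dg; first by rewrite comp1m.
exact: phantom_comp.
Qed.

Lemma proper_mono_cancel A B D (f : hom A B) (g : hom B D) :
  proper_mono xi (g ∘ f) -> proper_mono xi f.
Proof.
move=> [M [m [c /xi_phantom[d pc]]]].
have [F [v [w df]]] := dist_complete f.
apply/(proper_monoP df).
have [|n [_]] := dist_fill3 (a := idm A) (b := g) df d; first by rewrite compm1.
by rewrite fmor1 comp1m => ->; apply: phantom_comp.
Qed.

Lemma splitting_mono_proper A B (f : hom A B) : splitting_mono f -> proper_mono xi f.
Proof.
move=> sf; have [D [v [w d]]] := dist_complete f.
by apply/(proper_monoP d); rewrite (split_mono_w d sf); apply: phantom0.
Qed.

(** Equivalent extensions have equal connecting maps, so only these matter. *)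
Lemma ext_vanishesP A B :
  ext_vanishes xi A B <-> forall w : hom A (Σ B), phantom w -> w = 0.
Proof.
split=> [v w [E [u [p x]]]|v [E u p w x]].
  by have [e0 [s [h [_ _]]]] := v (Extension x); rewrite /= => <-.
have x' := x; exists (Extension x'); split; first by apply: v; exists E, u, p.
by exists (idm E); rewrite comp1m compm1.
Qed.

(* Membership in [CoFib] and in the trivial fibrations, with a single triangle
   as witness. *)
Definition mono_with_hocokernel (X : T -> Prop) : mor_class T := fun A B f =>
  exists D (v : hom B D) (w : hom D (Σ A)), xi (Triangle f v w) /\ X D.

Definition epi_with_hokernel (Y : T -> Prop) : mor_class T := fun A B f =>
  exists K (k : hom K A) (w : hom B (Σ K)), xi (Triangle k f w) /\ Y K.

Lemma mono_with_hocokernel_proper (X : T -> Prop) A B (f : hom A B) :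
  mono_with_hocokernel X f -> proper_mono xi f.
Proof. by move=> [D [v [w [x _]]]]; exists D, v, w. Qed.

Lemma epi_with_hokernel_deflation (Y : T -> Prop) A B (f : hom A B) :
  epi_with_hokernel Y f -> deflation f.
Proof. by move=> [K [k [w [x _]]]]; exists K, k, w. Qed.

Lemma CoFibP (X : additive_subcategory T) A B (f : hom A B) :
  CoFib xi X f <-> mono_with_hocokernel X f.
Proof.
split=> [[[D [v [w x]]] [D' [h XD']]]|[D [v [w [x XD]]]]].
  exists D, v, w; split=> //; apply: sub_retract XD'; apply: hocokernel_retract h.
  by exists v, w; apply: xi_dist x.
split; first by exists D, v, w.
by exists D; split=> //; exists v, w; apply: xi_dist x.
Qed.

Lemma epi_with_hokernelP (Y : additive_subcategory T) A B (f : hom A B) :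
  proper_epi xi f /\ (exists K, is_hokernel f K /\ Y K) <-> epi_with_hokernel Y f.
Proof.
rewrite proper_epi_deflation; split=> [[[K [k [w x]]] [K' [h YK']]]|[K [k [w [x YK]]]]].
  exists K, k, w; split=> //; apply: sub_retract YK'; apply: hokernel_retract h.
  by exists k, w; apply: xi_dist x.
split; first by exists K, k, w.
by exists K; split=> //; exists k, w; apply: xi_dist x.
Qed.

Section Subcategory.
Variable Y : additive_subcategory T.

Lemma hokernel_in A B (f : hom A B) K (k : hom K A) (w : hom B (Σ K)) :
  epi_with_hokernel Y f -> dist (Triangle k f w) -> Y K.
Proof.
move=> /epi_with_hokernelP[_ [K' [h YK']]] d; apply: sub_retract YK'.
by apply: hokernel_retract h; exists k, w.
Qed.

Lemma hocokernel_in A B (f : hom A B) D (v : hom B D) (w : hom D (Σ A)) :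
  mono_with_hocokernel Y f -> dist (Triangle f v w) -> Y D.
Proof.
move=> /CoFibP[_ [D' [h YD']]] d; apply: sub_retract YD'.
by apply: hocokernel_retract h; exists v, w.
Qed.

Lemma epi_with_hokernel_iso A' A B (g : hom A' A) (f : hom A B) :
  is_iso g -> epi_with_hokernel Y f -> epi_with_hokernel Y (f ∘ g).
Proof.
move=> [h [hg gh]] [K [k [w [x YK]]]]; exists K, (h ∘ k), w; split=> //.
apply: xi_iso x => //; exists (idm K), h, (idm B); split.
  by split; [exact: iso_id|exists g|exact: iso_id].
by rewrite /= -!compmA gh fmor1 !comp1m !compm1.
Qed.

(* A retract over [B] induces a retract of homotopy kernels. *)
Lemma epi_with_hokernel_retract A A' B (f : hom A B) (f' : hom A' B)
    (i : hom A A') (r : hom A' A) :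
  r ∘ i = idm A -> f ∘ r = f' -> epi_with_hokernel Y f' -> epi_with_hokernel Y f.
Proof.
move=> ri fr [K' [k' [w' [x' YK']]]].
have [K [k [w d]]] := dist_cocone f.
have d' := xi_dist xi_proper x'.
have df : deflation f.
  by apply: (@deflation_cancel _ _ _ r); rewrite fr; exists K', k', w'.
exists K, k, w; split; first by apply/xi_phantom; split=> //; apply/(deflationP d).
apply: sub_retract YK'.
apply: (cocone_retract (b := i) (c := idm B) (b' := r) (c' := idm B) d d') => //.
- by rewrite -fr -compmA ri compm1 comp1m.
- by rewrite comp1m.
- by rewrite comp1m.
Qed.

Lemma iso_epi_with_hokernel A B (f : hom A B) : is_iso f -> epi_with_hokernel Y f.
Proof.
move=> [g [gf fg]]; have [K [k [w d]]] := dist_cocone f.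
exists K, k, w; split.
  by apply/xi_phantom; split=> //; rewrite (split_epi_w d fg); apply: phantom0.
have k0 : k = 0 by rewrite -(comp1m k) -gf -compmA (dist_vu d) compm0.
have [|s es] := dist_extend1 d (s := idm K).
  by rewrite (split_epi_w d fg) compm0.
by apply: sub_retract (sub_zero Y); exists 0, 0; rewrite compm0 es k0 compm0.
Qed.

Lemma pr1_epi_with_hokernel A W : Y W -> epi_with_hokernel Y (pr1 : hom (A ⊕ W) A).
Proof.
move=> YW; have [K [k [w d]]] := dist_cocone (pr1 : hom (A ⊕ W) A).
have w0 := split_epi_w d (pr1_in1 A W).
exists K, k, w; split; first by apply/xi_phantom; split=> //; rewrite w0; apply: phantom0.
apply: sub_retract YW.
have [|x ex] := dist_lift d (f := in2); first exact: pr1_in2.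
have [|s es] := dist_extend1 d (s := idm K); first by rewrite w0 compm0.
(* [K] is a retract of [W]: as [pr1 ∘ k = 0], one gets [k ∘ x ∘ pr2 ∘ k = k], and [k] is split monic
   because [w = 0]. *)
exists (pr2 ∘ k), x.
suff kx : k ∘ (x ∘ (pr2 ∘ k)) = k by rewrite -[LHS]comp1m es -compmA kx.
have e : in2 ∘ pr2 = idm (A ⊕ W) - in1 ∘ pr1 by rewrite -bip_id addrC addKr.
rewrite !compmA -ex e compBl comp1m -compmA (dist_vu d) compm0; exact: subr0.
Qed.

End Subcategory.

End ProperClass.

(** * Relations between the three classes, and orthogonality *)

Section Classes.
Variables (T : triangulated_category) (xi : triangle T -> Prop).
Hypothesis xi_proper : proper_class xi.
Variables X Y : additive_subcategory T.
Implicit Types A B D E K : T.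

Local Notation omega := (subcategory_meet X Y).
Local Notation phantom := (phantom xi).
Local Notation cof := (mono_with_hocokernel xi X).
Local Notation tfib := (epi_with_hokernel xi Y).
Local Notation fib := (Fib omega).
Local Notation weq := (Weq xi omega Y).

Lemma WeqP A B (f : hom A B) :
  weq f <-> exists (W : T) (t : hom W B), omega W /\ tfib (copair f t).
Proof.
split=> [[W [t [? ? ?]]]|[W [t [? /(epi_with_hokernelP xi_proper)[? ?]]]]].
  by exists W, t; split=> //; apply/(epi_with_hokernelP xi_proper).
by exists W, t.
Qed.

Lemma tfib_weq A B (f : hom A B) : tfib f -> weq f.
Proof.
move=> tf; apply/WeqP; exists zero_obj, 0; split; first exact: sub_zero.
rewrite /copair comp0m addr0; apply: epi_with_hokernel_iso tf => //.
exact: pr1_zero_iso.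
Qed.

(** Since [W] lies in [omega], [t] lifts to [s] along the fibration [f]; then [(1, s)] retracts
    [(f, t)] onto [f] over [B]. *)
Lemma fib_weq_tfib A B (f : hom A B) : fib f -> weq f -> tfib f.
Proof.
move=> ff /WeqP[W [t [oW tf]]]; have [s fs] := ff W oW t.
apply: (epi_with_hokernel_retract xi_proper (i := in1) (r := copair (idm A) s)) tf.
  exact: copair_in1.
by rewrite comp_copair compm1 fs.
Qed.

Lemma fib_to_zero A (f : hom A zero_obj) : fib f.
Proof. by move=> W _ g; exists 0; rewrite [g]to_zero_obj compm0. Qed.

Lemma tfib_to_zero A (f : hom A zero_obj) : tfib f <-> Y A.
Proof.
have d : dist (Triangle (idm A) f 0) by rewrite (to_zero_obj f); apply: dist_id.
split=> [tf|YA]; first exact: (hokernel_in xi_proper tf d).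
exists A, (idm A), 0; split=> //.
by apply/(xi_phantom xi_proper); split=> //; apply: phantom0.
Qed.

Lemma cof_from_zero A (f : hom zero_obj A) : cof f <-> X A.
Proof.
have [D [v [w d]]] := dist_complete f.
have w0 : w = 0.
  by apply: split_mono_w d _; exists 0; rewrite [LHS]to_zero_obj [RHS]to_zero_obj.
have [|g gv] := dist_extend d (f := idm A); first by rewrite [LHS]from_zero_obj.
have [|h vh] := dist_lift3 d (f := idm D); first by rewrite w0 comp0m.
split=> [tf|XA].
  by apply: sub_retract (hocokernel_in xi_proper tf d); exists v, g.
exists D, v, w; split; last by apply: sub_retract XA; exists h, v.
by apply/(xi_phantom xi_proper); split=> //; rewrite w0; apply: phantom0.
Qed.

Section Orthogonality.
Hypothesis ext0 : forall A B (w : hom A (Σ B)), X A -> Y B -> phantom w -> w = 0.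

(** The obstruction is the composite of [g] with the connecting map of [q], an element of
    [Ext_xi(M, K) = 0]. *)
Lemma tfib_lift A B M (q : hom A B) (g : hom M B) :
  tfib q -> X M -> exists h, q ∘ h = g.
Proof.
move=> [K [k [w [/(xi_phantom xi_proper)[d pw] YK]]]] XM.
have [|h ->] := dist_lift3 d (f := g); last by exists h.
by apply: ext0 => //; apply: phantom_comp.
Qed.

Lemma cof_extend A B K (u : hom A B) (s : hom A K) :
  cof u -> Y K -> exists s', s' ∘ u = s.
Proof.
move=> [D [v [w [/(xi_phantom xi_proper)[d pw] XD]]]] YK.
have [|h ->] := dist_extend1 d (s := s); last by exists h.
by apply: ext0 => //; apply: phantom_susp.
Qed.

Lemma tfib_fib A B (f : hom A B) : tfib f -> fib f.
Proof. by move=> tf W [XW _] g; apply: tfib_lift. Qed.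

(** An object [B] orthogonal to [X] splits off the [E] in [Y] into which completeness embeds it;
    dually for [X]. *)
Lemma complete_cotorsion : complete_pair xi X Y -> cotorsion_pair xi X Y.
Proof.
move=> compl; split=> [B|A]; split.
- by move=> YB A XA; apply/ext_vanishesP => w; apply: ext0.
- move=> van; have [_ [E [D [u [v [w [YE XD x]]]]]]] := compl B.
  have [d pw] := iffLR (xi_phantom xi_proper _ _ _) x.
  move: (van D XD) => /ext_vanishesP/(_ _ pw) w0.
  have [|r ru] := dist_extend1 d (s := idm B); first by rewrite w0 compm0.
  by apply: sub_retract YE; exists u, r.
- by move=> XA B YB; apply/ext_vanishesP => w; apply: ext0.
- move=> van; have [[B [E [u [v [w [YB XE x]]]]]] _] := compl A.
  have [d pw] := iffLR (xi_phantom xi_proper _ _ _) x.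
  move: (van B YB) => /ext_vanishesP/(_ _ pw) w0.
  have [|s vs] := dist_lift3 d (f := idm A); first by rewrite w0 comp0m.
  by apply: sub_retract XE; exists s, v.
Qed.

(* An extension [E] of [K] by [B] embeds in some [Y']; then [B -> Y'] has its
   cone in [Y], so the map of cones [K -> cone] extends to [X1], which kills the
   class of [E]. *)
Lemma hereditary_from_right :
  complete_pair xi X Y -> cotorsion_pair xi X Y ->
  (forall (Y1 Y2 C : T) (u : hom Y1 Y2) (v : hom Y2 C) (w : hom C (Σ Y1)),
    xi (Triangle u v w) -> Y Y1 -> Y Y2 -> Y C) ->
  hereditary_pair xi X Y.
Proof.
move=> compl [_ cotX] herY; split=> // K X1 X2 u v w x X1X X2X.
apply/cotX => B YB; apply/ext_vanishesP => e [E [i [p y]]].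
have [_ [Y' [X' [a [b [c [YY' XX' z]]]]]]] := compl E.
have : proper_mono xi (a ∘ i).
  by apply: proper_mono_comp => //; [exists K, p, e|exists X', b, c].
move=> [C [q [e' t]]]; have YC := herY _ _ _ _ _ _ t YB YY'.
have [dt pe'] := iffLR (xi_phantom xi_proper _ _ _) t.
have [|k [_]] := dist_fill3 (a := idm B) (b := a) (xi_dist xi_proper y) dt.
  by rewrite compm1.
rewrite fmor1 comp1m => ->.
have [|k' <-] := cof_extend (u := u) k _ YC; first by exists X2, v, w.
by rewrite compmA (ext0 (w := e' ∘ k')) ?comp0m //; apply: phantom_comp.
Qed.

End Orthogonality.
End Classes.

(** * From a model structure to a cotorsion pair *)

Section ModelToCotorsion.
Variables (T : triangulated_category) (xi : triangle T -> Prop).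
Hypothesis xi_proper : proper_class xi.
Variables X Y : additive_subcategory T.

Local Notation omega := (subcategory_meet X Y).
Local Notation cof := (CoFib xi X).
Local Notation fib := (Fib omega).
Local Notation weq := (Weq xi omega Y).

Hypothesis model : is_model_structure cof fib weq.

Lemma model_ext0 (A B : T) (w : hom A (Σ B)) :
  X A -> Y B -> phantom xi w -> w = 0.
Proof.
move=> XA YB [E [u [v x]]].
have cu : cof u by apply/(CoFibP xi_proper); exists A, v, w.
have wB : weq (0 : hom B zero_obj) by apply: tfib_weq => //; apply/tfib_to_zero.
have [||h [hu _]] :=
  ms_lift model cu (fib_to_zero (0 : hom B zero_obj)) _ (a := idm B) (b := 0).
- by right.
- by rewrite !comp0m.
- by apply: split_mono_w (xi_dist xi_proper x) _; exists h.
Qed.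

Lemma model_complete : complete_pair xi X Y.
Proof.
move=> A; split.
- have [E [j [q [_ /(CoFibP xi_proper) cj fq wq]]]] :=
    ms_fact_cof_tfib model (0 : hom zero_obj A).
  have [K [k [w [x YK]]]] := fib_weq_tfib xi_proper fq wq.
  by exists K, E, k, q, w; split=> //; apply/(cof_from_zero xi_proper X j).
- have [E [j [q [_ /(CoFibP xi_proper) cj fq wq]]]] :=
    ms_fact_cof_tfib model (0 : hom A zero_obj).
  have [D [v [w [x XD]]]] := cj.
  exists E, D, j, v, w; split=> //; apply/(tfib_to_zero xi_proper Y q).
  exact: fib_weq_tfib fq wq.
Qed.

(** Both [v] and [Y2 -> 0] are weak equivalences, hence so is [C -> 0] by two-out-of-three; being
    also a fibration, it has its hokernel [C] in [Y]. *)
Lemma model_hereditary_right (Y1 Y2 C : T)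
    (u : hom Y1 Y2) (v : hom Y2 C) (w : hom C (Σ Y1)) :
  xi (Triangle u v w) -> Y Y1 -> Y Y2 -> Y C.
Proof.
move=> x YY1 YY2; apply/(tfib_to_zero xi_proper Y 0).
apply: fib_weq_tfib => //; first exact: fib_to_zero.
have wv : weq v by apply: tfib_weq => //; exists Y1, u, w.
apply: (ms_two_three model v 0).2.1 => //.
by apply: tfib_weq => //; apply/tfib_to_zero.
Qed.

Lemma model_cotorsion : hereditary_complete_cotorsion_pair xi X Y.
Proof.
have cot := complete_cotorsion xi_proper model_ext0 model_complete.
split; [exact: cot|exact: model_complete|].
apply: hereditary_from_right cot _ => //; first exact: model_ext0.
  exact: model_complete.
exact: model_hereditary_right.
Qed.

(** Factor [0 -> A] as a trivial cofibration [i] and a fibration [p : E -> A]. As [E] lies in [X],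
    the proper epimorphism onto [E] witnessing that [i] is a weak equivalence splits, so [E] is a
    retract of some [W] in [omega]. *)
Lemma model_contravariantly_finite : contravariantly_finite omega.
Proof.
move=> A; have [E [i [p [_ ci wi fp]]]] := ms_fact_tcof_fib model (0 : hom zero_obj A).
have XE : X E by apply/(cof_from_zero xi_proper X i); apply/CoFibP.
exists E, p; split=> [|W g oW]; last exact: fp.
have /(WeqP xi_proper)[W [t [oW tt]]] := wi.
have [h th] := tfib_lift xi_proper model_ext0 (idm E) tt XE.
apply: (@sub_retract T omega _ W) oW; exists (pr2 ∘ h), t.
by rewrite compmA -[RHS]th /copair [i]from_zero_obj comp0m add0r.
Qed.

End ModelToCotorsion.

(** * Universal property of a quotient category *)

Section QuotientFunctors.
Variables (C : category) (R : congruence C).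

Lemma quot_class_comp (A B D : C) (g : hom B D) (f : hom A B) :
  quot_class R (g ∘ f) = quot_comp (quot_class R g) (quot_class R f).
Proof. by apply/quot_classP/cong_sym/cong_comp; apply: cong_repr. Qed.

Definition quot_functor : functor C (quotient_category R) :=
  @Functor C (quotient_category R) id (fun A B f => quot_class R f)
    (fun=> erefl) quot_class_comp.

Lemma quot_functor_eq (A B : C) (f g : hom A B) :
  quot_functor @@ f = quot_functor @@ g <-> cong R f g.
Proof. exact: quot_classP. Qed.

Lemma quot_functor_full (A B : C) (f : hom (quot_functor A) (quot_functor B)) :
  exists g : hom A B, quot_functor @@ g = f.
Proof. by exists (quot_repr f); apply: quot_reprK. Qed.

Variables (D : category) (F : functor C D).
Hypothesis F_cong : forall (A B : C) (f g : hom A B), cong R f g -> F @@ f = F @@ g.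

Lemma quot_lift_id (A : C) :
  F @@ quot_repr (quot_class R (idm A)) = idm (F A).
Proof. by rewrite -fmor1; apply/F_cong/cong_repr. Qed.

Lemma quot_lift_comp (A B E : C) (g : quot_hom R B E) (f : quot_hom R A B) :
  F @@ quot_repr (quot_comp g f) = (F @@ quot_repr g) ∘ (F @@ quot_repr f).
Proof. by rewrite -fmorM; apply/F_cong/cong_repr. Qed.

Definition quot_lift : functor (quotient_category R) D :=
  @Functor (quotient_category R) D (fun A => F A)
    (fun A B f => F @@ quot_repr f) quot_lift_id quot_lift_comp.

Lemma quot_liftE (A B : C) (f : hom A B) :
  quot_lift @@ (quot_functor @@ f) = F @@ f.
Proof. exact/F_cong/cong_repr. Qed.

End QuotientFunctors.

(** * Universal property of the localization *)

Section LocalizationFunctors.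
Variables (C : category) (W : mor_class C).

Definition zigzag_loc : functor (zigzag_category W) (localization W) :=
  quot_functor (zigzag_congruence W).

Lemma zigzag_loc_cat (A B D : C) (p : zigzag W A B) (q : zigzag W B D) :
  zigzag_loc @@ (zcat p q) = (zigzag_loc @@ q) ∘ (zigzag_loc @@ p).
Proof. exact: (fmorM zigzag_loc). Qed.

Lemma loc_functor_id (A : C) :
  zigzag_loc @@ (zfwd (idm A) (znil W A)) = idm (zigzag_loc A).
Proof. by apply/quot_functor_eq; apply: zr_id. Qed.

Lemma loc_functor_comp (A B D : C) (g : hom B D) (f : hom A B) :
  zigzag_loc @@ (zfwd (g ∘ f) (znil W D)) =
  (zigzag_loc @@ zfwd g (znil W D)) ∘ (zigzag_loc @@ zfwd f (znil W B)).
Proof. by rewrite -zigzag_loc_cat; apply/quot_functor_eq/zr_sym/zr_comp. Qed.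

Definition loc_functor : functor C (localization W) :=
  @Functor C (localization W) id (fun A B f => zigzag_loc @@ (zfwd f (znil W B)))
    loc_functor_id loc_functor_comp.

Definition loc_inv (A B : C) (s : hom A B) (Ws : W s) :
    hom (loc_functor B) (loc_functor A) :=
  zigzag_loc @@ (zbwd Ws (znil W A)).

Lemma loc_invl (A B : C) (s : hom A B) (Ws : W s) :
  loc_inv Ws ∘ (loc_functor @@ s) = idm (loc_functor A).
Proof.
apply: etrans (esym (zigzag_loc_cat _ _)) _; exact/quot_functor_eq/zr_fwd_bwd.
Qed.

Lemma loc_invr (A B : C) (s : hom A B) (Ws : W s) :
  (loc_functor @@ s) ∘ loc_inv Ws = idm (loc_functor B).
Proof.
apply: etrans (esym (zigzag_loc_cat _ _)) _; exact/quot_functor_eq/zr_bwd_fwd.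
Qed.

Lemma loc_iso (A B : C) (s : hom A B) : W s -> is_iso (loc_functor @@ s).
Proof. by move=> Ws; exists (loc_inv Ws); rewrite loc_invl loc_invr. Qed.

Variable D : category.

(** Induction along the zigzag; at a backward arrow [s], the equation is tested after precomposing
    with the invertible image of [s]. *)
Lemma loc_natural (H K : functor (localization W) D)
    (a : forall A : C, hom (H A) (K A)) :
  (forall (A B : C) (f : hom A B),
     a B ∘ (H @@ loc_functor @@ f) = (K @@ loc_functor @@ f) ∘ a A) ->
  forall (A B : localization W) (f : hom A B), a B ∘ (H @@ f) = (K @@ f) ∘ a A.
Proof.
move=> nat A B f; have [z <-] := quot_functor_full f.
rewrite -/zigzag_loc; elim: z => {A B f} [A|A B E f z IH|A B E s Ws z IH].
- by rewrite [zigzag_loc @@ _]fmor1 !fmor1 comp1m compm1.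
- have -> : zigzag_loc @@ zfwd f z = (zigzag_loc @@ z) ∘ (loc_functor @@ f).
    exact: (zigzag_loc_cat (zfwd f (znil W _))).
  by rewrite !fmorM compmA IH -!compmA nat.
- have -> : zigzag_loc @@ zbwd Ws z = (zigzag_loc @@ z) ∘ loc_inv Ws.
    exact: (zigzag_loc_cat (zbwd Ws (znil W _))).
  rewrite !fmorM compmA IH -!compmA; congr (_ ∘ _).
  apply: (iso_epi (fmor_iso H (loc_iso Ws))).
  by rewrite -!compmA -fmorM loc_invl nat compmA -fmorM loc_invl !fmor1 comp1m compm1.
Qed.

Variable F : functor C D.
Hypothesis F_iso : forall (A B : C) (f : hom A B), W f -> is_iso (F @@ f).

Fixpoint zeval (A B : C) (z : zigzag W A B) : hom (F A) (F B) :=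
  match z with
  | znil A => idm (F A)
  | zfwd _ _ _ f z' => zeval z' ∘ (F @@ f)
  | zbwd _ _ _ _ Ws z' => zeval z' ∘ sval (cid (F_iso Ws))
  end.

Lemma zeval_cat (A B E : C) (q : zigzag W B E) (p : zigzag W A B) :
  zeval (zcat p q) = zeval q ∘ zeval p.
Proof.
elim: p q => [A' q|A' B' E' f p IH q|A' B' E' s Ws p IH q] /=.
- by rewrite compm1.
- by rewrite IH compmA.
- by rewrite IH compmA.
Qed.

Definition zeval_functor : functor (zigzag_category W) D :=
  @Functor (zigzag_category W) D (fun A => F A) zeval (fun=> erefl) zeval_cat.

Lemma zeval_rel (A B : C) (p q : zigzag W A B) :
  zigzag_rel p q -> zeval p = zeval q.
Proof.
elim=> {A B p q} //=.
- by move=> A B p q r _ -> _ ->.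
- by move=> A B E p p' q q' _ ep _ eq; rewrite !zeval_cat ep eq.
- by move=> A; rewrite fmor1 compm1.
- by move=> A B E f g; rewrite !comp1m fmorM.
- by move=> A B s Ws; case: cid => /= g [gs sg]; rewrite comp1m.
- by move=> A B s Ws; case: cid => /= g [gs sg]; rewrite comp1m.
Qed.

Definition loc_lift : functor (localization W) D :=
  quot_lift (R := zigzag_congruence W) (F := zeval_functor) zeval_rel.

Lemma loc_liftE (A B : C) (f : hom A B) :
  loc_lift @@ (loc_functor @@ f) = F @@ f.
Proof.
have := quot_liftE (R := zigzag_congruence W) (F := zeval_functor) zeval_rel
  (zfwd f (znil W B)).
by rewrite /= comp1m.
Qed.

End LocalizationFunctors.

Definition full_inclusion (C : category) (P : C -> Prop) :
    functor (full_subcategory P) C :=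
  @Functor (full_subcategory P) C (fun A => sval A) (fun _ _ f => f)
    (fun=> erefl) (fun _ _ _ _ _ => erefl).

(** * From a cotorsion pair to a model structure *)

Section CotorsionToModel.
Variables (T : triangulated_category) (xi : triangle T -> Prop).
Hypothesis xi_proper : proper_class xi.
Variables X Y : additive_subcategory T.
Implicit Types A B D E K M : T.

Local Notation omega := (subcategory_meet X Y).
Local Notation phantom := (phantom xi).
Local Notation cof := (mono_with_hocokernel xi X).
Local Notation tfib := (epi_with_hokernel xi Y).
Local Notation fib := (Fib omega).
Local Notation weq := (Weq xi omega Y).

Hypothesis cotorsion : hereditary_complete_cotorsion_pair xi X Y.

Let xiP := xi_phantom xi_proper.

Lemma cotorsion_ext0 A B (w : hom A (Σ B)) : X A -> Y B -> phantom w -> w = 0.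
Proof.
by case: cotorsion => [[_ cotX] _ _] /cotX/(_ B)/[apply]/ext_vanishesP; apply.
Qed.

Let ext0 := cotorsion_ext0.

(** Exactness of [Ext_xi(M, A) -> Ext_xi(M, B) -> Ext_xi(M, D)]: the lift [g] of the class [f] is
    phantom by cosaturation, hence zero. *)
Lemma Y_extension A B D (u : hom A B) (v : hom B D) (w : hom D (Σ A)) :
  xi (Triangle u v w) -> Y A -> Y D -> Y B.
Proof.
case: (cotorsion) => [[cotY _] _ _] x YA YD; apply/cotY => M XM.
have [/dist_rotate d _] := iffLR (xiP _ _ _) x.
apply/ext_vanishesP => f pf.
have [|g fE] := dist_lift1 d (f := f).
  exact: ext0 XM YD (phantom_susp xi_proper v pf).
have pg : phantom g.
  apply: (phantom_cosaturated xi_proper x).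
  by rewrite -(opprK (_ ∘ g)) -compNm -fE; apply: phantomN.
by rewrite fE (ext0 XM YA pg) compm0.
Qed.

Lemma X_extension A B D (u : hom A B) (v : hom B D) (w : hom D (Σ A)) :
  xi (Triangle u v w) -> X A -> X D -> X B.
Proof.
case: (cotorsion) => [[_ cotX] _ _] x XA XD; apply/cotX => K YK.
have [d _] := iffLR (xiP _ _ _) x.
apply/ext_vanishesP => f pf.
have [|g fE] := dist_extend d (f := f).
  exact: ext0 XA YK (phantom_comp xi_proper u pf).
have pg : phantom g by apply: (phantom_saturated xi_proper x); rewrite -fE.
by rewrite fE (ext0 XD YK pg) comp0m.
Qed.

(** By the octahedron, the hokernel of [g ∘ f] is an extension in [xi] of those of [g] and [f]. *)
Lemma tfib_comp A B D (f : hom A B) (g : hom B D) : tfib f -> tfib g -> tfib (g ∘ f).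
Proof.
move=> tf tg; have [M [m [c d]]] := dist_cocone (g ∘ f).
have : deflation xi (g ∘ f).
  by apply: deflation_comp => //; apply: epi_with_hokernel_deflation; eassumption.
move/(deflationP xi_proper d) => pc.
move: tf tg => [K [k [w [/xiP[df pw] YK]]]] [L [l [e [/xiP[dg pe] YL]]]].
have [a [b [dab _ _]]] := hokernel_comp df dg d.
exists M, m, c; split; first exact/xiP.
by apply: Y_extension YK YL; apply/xiP; split; [exact: dab|exact: phantom_comp].
Qed.

(** Completeness embeds [M] in an [E] in [Y] with cone in [X]; then [E] lies in [omega] by closure
    under extensions, and [g] extends to [E]. *)
Lemma hom_XY_factors M K (g : hom M K) : X M -> Y K -> factors_through omega g.
Proof.
case: (cotorsion) => [_ compl _] XM YK.
have [_ [E [D [u [v [w [YE XD x]]]]]]] := compl M.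
have [s <-] := cof_extend xi_proper ext0 (u := u) g
  (ex_intro _ _ (ex_intro _ _ (ex_intro _ _ (conj x XD)))) YK.
exists E; split; last by exists u, s.
by split=> //; apply: X_extension x XM XD.
Qed.

(** The difference of the lifts factors through the hokernel of [q], by a map from an object of [X]
    to one of [Y]. *)
Lemma tfib_lift_unique A B M (q : hom A B) (h h' : hom M A) :
  tfib q -> X M -> q ∘ h = q ∘ h' -> factors_through omega (h - h').
Proof.
move=> [K [k [w [/xiP[d _] YK]]]] XM e.
have [|s ->] := dist_lift d (f := h - h'); first by rewrite compBr e subrr.
by rewrite -(compm1 (k ∘ s)); apply: factors_comp; apply: hom_XY_factors.
Qed.

(** * Cofibrant replacement *)

Local Notation quotient := (additive_quotient X omega).
Local Notation cls := (quot_functor (sub_quot_congruence X omega)).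

Lemma cls_eq (A B : full_subcategory X) (f g : hom (sval A) (sval B)) :
  factors_through omega (f - g) ->
  cls @@ (f : hom A B) = cls @@ (g : hom A B).
Proof. by move=> fg; apply/quot_functor_eq. Qed.

Lemma cls_eqP (A B : full_subcategory X) (f g : hom (sval A) (sval B)) :
  cls @@ (f : hom A B) = cls @@ (g : hom A B) -> factors_through omega (f - g).
Proof. by move/quot_functor_eq. Qed.

Lemma tfib_iso (M N : full_subcategory X) (q : hom (sval M) (sval N)) :
  tfib q -> is_iso (cls @@ (q : hom M N)).
Proof.
move=> tq; have [s qs] := tfib_lift xi_proper ext0 (idm (sval N)) tq (svalP N).
exists (cls @@ (s : hom N M)); split.
- rewrite -fmorM -[RHS](fmor1 cls); apply: cls_eq.
  by apply: (tfib_lift_unique tq (svalP M)); rewrite compmA qs comp1m compm1.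
- by rewrite -fmorM -[RHS](fmor1 cls) /= qs.
Qed.

Lemma cofibrant_replacement_exists A :
  exists r : {M : full_subcategory X & hom (sval M) A}, tfib (tagged r).
Proof.
case: (cotorsion) => [_ compl _].
have [[B [M [u [v [w [YB XM x]]]]]] _] := compl A.
by exists (existT (fun M : full_subcategory X => hom (sval M) A) (exist _ M XM) v);
   exists B, u, w.
Qed.

Definition cofrep A : full_subcategory X :=
  tag (sval (cid (cofibrant_replacement_exists A))).

Definition cofrep_map A : hom (sval (cofrep A)) A :=
  tagged (sval (cid (cofibrant_replacement_exists A))).

Lemma cofrep_tfib A : tfib (cofrep_map A).
Proof. exact: (svalP (cid (cofibrant_replacement_exists A))). Qed.

Lemma cofrep_lift_exists A B (f : hom A B) :
  exists h : hom (cofrep A) (cofrep B), cofrep_map B ∘ h = f ∘ cofrep_map A.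
Proof.
exact: (tfib_lift xi_proper ext0 (f ∘ cofrep_map A) (cofrep_tfib B) (svalP (cofrep A))).
Qed.

Definition cofrep_lift A B (f : hom A B) : hom (cofrep A) (cofrep B) :=
  sval (cid (cofrep_lift_exists f)).

Lemma cofrep_liftE A B (f : hom A B) :
  cofrep_map B ∘ cofrep_lift f = f ∘ cofrep_map A.
Proof. exact: (svalP (cid (cofrep_lift_exists f))). Qed.

Lemma cofrep_lift_unique B (M : full_subcategory X) (g h : hom M (cofrep B)) :
  cofrep_map B ∘ g = cofrep_map B ∘ h -> cls @@ g = cls @@ h.
Proof.
by move=> e; apply: cls_eq; apply: tfib_lift_unique (cofrep_tfib B) (svalP M) e.
Qed.

Lemma cofrep_fun_id A : cls @@ cofrep_lift (idm A) = idm (cls (cofrep A)).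
Proof.
rewrite -[RHS](fmor1 cls); apply: cofrep_lift_unique.
by rewrite /= cofrep_liftE comp1m compm1.
Qed.

Lemma cofrep_fun_comp A B D (g : hom B D) (f : hom A B) :
  cls @@ cofrep_lift (g ∘ f) = (cls @@ cofrep_lift g) ∘ (cls @@ cofrep_lift f).
Proof.
rewrite -[RHS](fmorM cls); apply: cofrep_lift_unique.
by rewrite /= cofrep_liftE compmA cofrep_liftE -!compmA cofrep_liftE.
Qed.

Definition cofrep_functor : functor T quotient :=
  @Functor T quotient (fun A => cls (cofrep A)) (fun A B f => cls @@ cofrep_lift f)
    cofrep_fun_id cofrep_fun_comp.

(** [cofrep A -> A -> B] is another replacement of [B]; comparison with [cofrep B] gives the
    inverse. *)
Lemma tfib_cofrep_iso A B (f : hom A B) : tfib f -> is_iso (cofrep_functor @@ f).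
Proof.
move=> tf; have tfp := tfib_comp (cofrep_tfib A) tf.
have [g gE] := tfib_lift xi_proper ext0 (cofrep_map B) tfp (svalP (cofrep B)).
exists (cls @@ (g : hom (cofrep B) (cofrep A))); split.
- rewrite -[LHS](fmorM cls) -[RHS](fmor1 cls); apply: cls_eq.
  apply: tfib_lift_unique tfp (svalP (cofrep A)) _.
  by rewrite /= compmA gE cofrep_liftE compm1.
- rewrite -[LHS](fmorM cls) -[RHS](fmor1 cls); apply: cofrep_lift_unique.
  by rewrite /= compmA cofrep_liftE gE compm1.
Qed.

Lemma copair_id_tfib A W (t : hom W A) : Y W -> tfib (copair (idm A) t).
Proof.
move=> YW.
(* A shear of [A ⊕ W], with inverse [s (- t)]; it carries [pr1] to [(1, t)]. *)
set s : hom W A -> hom (A ⊕ W) (A ⊕ W) := fun t => bpair (copair (idm A) t) pr2.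
have ss t1 t2 : t1 + t2 = 0 -> s t1 ∘ s t2 = idm (A ⊕ W).
  move=> t0; rewrite [LHS]bpair_eta [RHS]bpair_eta !compmA pr1_bpair pr2_bpair.
  rewrite copair_bpair pr2_bpair comp1m !compm1; congr bpair.
  by rewrite /copair comp1m -addrA -compDl (addrC t2) t0 comp0m addr0.
have -> : copair (idm A) t = pr1 ∘ s t by rewrite pr1_bpair.
apply: epi_with_hokernel_iso => //; last exact: pr1_epi_with_hokernel.
by exists (s (- t)); rewrite !ss ?addNr ?addrN.
Qed.

(** By the octahedron, the hokernels of [f], [g ∘ f] and [g] form a triangle in [xi]; the first two
    lie in [Y], so heredity applies. *)
Lemma tfib_cancel A B D (f : hom A B) (g : hom B D) :
  tfib f -> tfib (g ∘ f) -> tfib g.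
Proof.
case: (cotorsion) => [_ _ [_ herY]] [K [k [w [/xiP[df pw] YK]]]] tgf.
have [M [m [c [/xiP[dgf pc] YM]]]] := tgf.
have [L [l [e d]]] := dist_cocone g.
exists L, l, e; split.
  apply/xiP; split=> //; apply/(deflationP xi_proper d).
  exact/(deflation_cancel xi_proper)/(epi_with_hokernel_deflation tgf).
have [a [b [dab _ _]]] := hokernel_comp df d dgf.
by apply: herY _ YK YM; apply/xiP; split; [exact: dab|exact: phantom_comp].
Qed.

Lemma cls_iso_inverse (M N : full_subcategory X) (g : hom (sval M) (sval N)) :
  is_iso (cls @@ (g : hom M N)) -> exists h : hom (sval N) (sval M),
    factors_through omega (h ∘ g - idm (sval M)) /\
    factors_through omega (g ∘ h - idm (sval N)).
Proof.
move=> [h0 []]; have [h <-] := quot_functor_full h0.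
rewrite -[X in X = _](fmorM cls) -[X in _ = X](fmor1 cls) => /cls_eqP e1.
rewrite -[X in X = _](fmorM cls) -[X in _ = X](fmor1 cls) => /cls_eqP e2.
by exists h.
Qed.

(* With [M] the replacement of [A], an inverse of the image of [f] exhibits
   [M -> B] as a retract over [B] of [cofrep B ⊕ W -> B] for some [W] in [omega]. *)
Lemma fib_iso_tfib A B (f : hom A B) :
  fib f -> is_iso (cofrep_functor @@ f) -> tfib f.
Proof.
move=> ff /cls_iso_inverse[h [hg [W [oW [a [b e]]]]]].
move: (cofrep_lift f : hom (sval (cofrep A)) (sval (cofrep B))) (cofrep_liftE f) hg e.
move=> g gE hg e; pose M := sval (cofrep A).
have [c fc] : exists c : hom W M, f ∘ cofrep_map A ∘ c = cofrep_map B ∘ b.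
  have [c1 fc1] := ff W oW (cofrep_map B ∘ b).
  have [c cc1] := tfib_lift xi_proper ext0 c1 (cofrep_tfib A) oW.1.
  by exists c; rewrite -compmA cc1.
(* Subtracting [c ∘ a] absorbs the map through [W] by which [g ∘ h] differs from the identity, so
   [h'] lies strictly over [B]. *)
pose h' := h - c ∘ a; have fh : f ∘ cofrep_map A ∘ h' = cofrep_map B.
  rewrite compBr compmA fc -gE -2!(compmA (cofrep_map B)) -compBr.
  by rewrite -e opprB addrC subrK compm1.
have [W' [[XW' YW'] [a' [b' e']]]] : factors_through omega (h' ∘ g - idm M).
  rewrite /h' compBl addrAC; apply: factorsD hg _; apply: factorsN.
  by exists W; split=> //; exists (a ∘ g), c; rewrite compmA.
have [d de] := tfib_lift xi_proper ext0 (f ∘ cofrep_map A ∘ b') (cofrep_tfib B) XW'.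
apply: (tfib_cancel (cofrep_tfib A)).
apply: (epi_with_hokernel_retract xi_proper (i := bpair g a') (r := copair h' (- b'))
  (f' := cofrep_map B ∘ copair (idm _) (- d))).
- by rewrite copair_bpair compNm -e' opprB addrC subrK.
- by rewrite !comp_copair !compmN fh de compm1.
- by apply: tfib_comp (cofrep_tfib B); apply: copair_id_tfib.
Qed.

(** [f] is [(f, t)] after [in1], a section of the trivial fibration [pr1]; both [(f, t)] and [pr1]
    are inverted. *)
Lemma weq_cofrep_iso A B (f : hom A B) : weq f -> is_iso (cofrep_functor @@ f).
Proof.
move=> /(WeqP xi_proper)[W [t [[_ YW] tf]]].
rewrite -(copair_in1 f t) fmorM; apply: iso_comp; last exact: tfib_cofrep_iso.
apply: (iso_cancel_l (g := cofrep_functor @@ pr1)).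
  by apply: tfib_cofrep_iso; apply: pr1_epi_with_hokernel.
by rewrite -fmorM pr1_in1 fmor1; apply: iso_id.
Qed.

Hypothesis omega_finite : contravariantly_finite omega.

(** With [t] a right [omega]-approximation of [B], maps from [omega] to [B] already lift to the
    summand [W]. *)
Lemma fib_copair A B :
  exists (W : T) (t : hom W B), omega W /\ forall f : hom A B, fib (copair f t).
Proof.
have [W [t [oW tt]]] := omega_finite B; exists W, t; split=> // f W' oW' g.
by have [h <-] := tt W' g oW'; exists (in2 ∘ h); rewrite compmA copair_in2.
Qed.

(** Conversely, the fibration [(f, t)] is inverted along with [f], because [in1] is, so it is a
    trivial fibration. *)
Lemma cofrep_isoP A B (f : hom A B) : weq f <-> is_iso (cofrep_functor @@ f).
Proof.
split; first exact: weq_cofrep_iso.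
move=> isof; have [W [t [oW ft]]] := fib_copair A B.
apply/(WeqP xi_proper); exists W, t; split=> //; apply: fib_iso_tfib => //.
apply: (iso_cancel_r (f := cofrep_functor @@ in1)); last by rewrite -fmorM copair_in1.
apply: (iso_cancel_l (g := cofrep_functor @@ pr1)).
  by apply: tfib_cofrep_iso; apply: pr1_epi_with_hokernel => //; exact: oW.2.
by rewrite -fmorM pr1_in1 fmor1; apply: iso_id.
Qed.

(** * The model structure *)

(** There are two obstructions. [z ∘ b] vanishes on [A], so it comes from a map out of the cone [F]
    in [X], phantom by saturation and hence zero. A lift [b'] of [b] then differs from [a] on [A] by
    a map to [K] in [Y], which extends along [i]. *)
Lemma cof_tfib_lifting A B D E (i : hom A B) (p : hom D E) :
  cof i -> tfib p -> has_lifting i p.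
Proof.
move=> ci tp a b pa; move: (ci) (tp) => [F [v [w [xF XF]]]] [K [k [z [/xiP[d pz] YK]]]].
have [dF pw] := iffLR (xiP _ _ _) xF.
have zb : z ∘ b = 0.
  have [|e eE] := dist_extend dF (f := z ∘ b).
    by rewrite -compmA -pa compmA (dist_wv d) comp0m.
  rewrite eE (ext0 (w := e)) ?comp0m //; apply: (phantom_saturated xi_proper xF).
  by rewrite -eE; apply: phantom_comp.
have [b' bE] := dist_lift3 d zb.
have [|s sE] := dist_lift d (f := b' ∘ i - a).
  by rewrite compBr compmA -bE pa subrr.
have [s' s'E] := cof_extend xi_proper ext0 s ci YK.
exists (b' - k ∘ s'); split.
- by rewrite compBl -compmA s'E -sE subKr.
- by rewrite compBr compmA (dist_vu d) comp0m subr0.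
Qed.

Lemma weq_fact A B (f : hom A B) : weq f ->
  exists (W : T) (q : hom (A ⊕ W) B), [/\ omega W, tfib q & q ∘ in1 = f].
Proof.
move=> /(WeqP xi_proper)[W [t [oW tf]]].
by exists W, (copair f t); rewrite copair_in1.
Qed.

(** A trivial cofibration is [q ∘ in1] with [q] a trivial fibration; lifting exhibits it as a
    retract of [in1] under [A], so its cone is a retract of [W]. *)
Lemma cof_weqP A B (f : hom A B) :
  cof f /\ weq f <-> splitting_mono f /\ exists D, is_hocokernel f D /\ omega D.
Proof.
split=> [[cf /weq_fact[W [q [oW tq qf]]]]|[sf [D [[v [w d]] [XD YD]]]]].
  have [h [hf qh]] : exists h, h ∘ f = in1 /\ q ∘ h = idm B.
    by apply: (cof_tfib_lifting cf tq); rewrite qf comp1m.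
  have sf : splitting_mono f.
    by exists (pr1 ∘ h); rewrite -compmA hf pr1_in1.
  split=> //; move: cf => [D [v [w [/xiP[d _] XD]]]].
  exists D; split; first by exists v, w.
  apply: (@sub_retract T omega D W) oW.
  apply: (cone_retract (a := idm A) (a' := idm A) (b := h) (b' := q) d
    (dist_in1 A W)) => //;
    by rewrite ?compm1 ?comp1m ?hf.
split; last first.
  have [s [ci _]] := split_mono_iso d sf.
  apply/(WeqP xi_proper); exists D, s; split=> //.
  exact: iso_epi_with_hokernel.
exists D, v, w; split=> //; apply/xiP; split=> //.
by rewrite (split_mono_w d sf); apply: phantom0.
Qed.

Lemma weq_two_out_of_three : two_out_of_three weq.
Proof.
move=> A B D f g; split; [|split]; move=> /cofrep_isoP i1 /cofrep_isoP i2;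
  apply/cofrep_isoP; move: i1 i2; rewrite fmorM.
- exact: iso_comp.
- exact: iso_cancel_r.
- exact: iso_cancel_l.
Qed.

Lemma weq_retract : closed_under_retracts weq.
Proof.
move=> A B A' B' f g fg /cofrep_isoP ig; apply/cofrep_isoP.
by apply: iso_retract ig; apply: fmor_retract.
Qed.

Lemma fib_retract : closed_under_retracts fib.
Proof.
move=> A B A' B' f g [i [r [j [q [ri qj gi fr]]]]] fg W oW x.
have [h gh] := fg W oW (j ∘ x); exists (r ∘ h).
by rewrite compmA fr -compmA gh compmA qj comp1m.
Qed.

Lemma cof_retract : closed_under_retracts (CoFib xi X).
Proof.
move=> A B A' B' f g [i [r [j [q [ri qj gi fr]]]]] /(CoFibP xi_proper) cg.
apply/(CoFibP xi_proper); have [D [v [w d]]] := dist_complete f.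
have pf : proper_mono xi f.
  apply: (@proper_mono_cancel _ _ xi_proper _ _ _ f j); rewrite -gi.
  apply: proper_mono_comp => //; last exact: mono_with_hocokernel_proper cg.
  by apply: splitting_mono_proper => //; exists r.
move: cg => [D' [v' [w' [/xiP[d' _] XD']]]].
exists D, v, w; split; first by apply/xiP; split=> //; apply/(proper_monoP xi_proper d).
by apply: sub_retract XD'; apply: (cone_retract d d' (esym gi) _ ri qj).
Qed.

Lemma proper_mono_bpair A B (a : hom A B) E (f : hom A E) :
  cof a -> proper_mono xi (bpair f a).
Proof.
move=> /mono_with_hocokernel_proper pa.
by apply: (@proper_mono_cancel _ _ xi_proper _ _ _ _ pr2); rewrite pr2_bpair.
Qed.

(* First embed [A] in [B ⊕ Y'], then pull the cone [D] back along a trivial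
   fibration [M -> D] with [M] in [X]; the result lies over [B ⊕ Y'] by a trivial
   fibration, and the cone of [A] is now [M]. *)
Lemma cof_tfib_fact A B (f : hom A B) :
  exists (E : T) (j : hom A E) (q : hom E B), [/\ f = q ∘ j, cof j & tfib q].
Proof.
case: (cotorsion) => [_ compl _].
have [_ [Y' [X' [a [b [c [YY' XX' x]]]]]]] := compl A.
have : proper_mono xi (bpair f a) by apply: proper_mono_bpair; exists X', b, c.
move=> [D [v [w xD]]]; have [d pw] := iffLR (xiP _ _ _) xD.
have [[K [M [k [p [z [YK XM /xiP[dM pz]]]]]]] _] := compl D.
have [E [j [e dE]]] := dist_cocone2 (w ∘ p).
have [m [n [dmn nj _]]] := hokernel_comp dM
  (iffLR (dist_rotate _ _ _) d) (iffLR (dist_rotate _ _ _) dE).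
have njE : n ∘ j = bpair f a.
  by apply: susp_faithful; rewrite fmorM; apply: oppr_inj; rewrite -compmN.
exists E, j, (pr1 ∘ n); split.
- by rewrite -compmA njE pr1_bpair.
- by exists M, e, (w ∘ p); split=> //; apply/xiP; split=> //; apply: phantom_comp.
- apply: tfib_comp; last exact: pr1_epi_with_hokernel.
  by exists K, m, (z ∘ v); split=> //; apply/xiP; split=> //; apply: phantom_comp.
Qed.

Lemma cotorsion_model : is_model_structure (CoFib xi X) fib weq.
Proof.
split.
- exact: weq_two_out_of_three.
- exact: cof_retract.
- exact: fib_retract.
- exact: weq_retract.
- move=> A B D E i p /(CoFibP xi_proper) ci fp [wi|wp]; last first.
    exact: cof_tfib_lifting ci (fib_weq_tfib xi_proper fp wp).
  have [[r ri] [W [[v [w d]] oW]]] := iffLR (cof_weqP i) (conj ci wi).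
  (* The first guess is [a ∘ r]; its defect [b - p ∘ a ∘ r] factors through [W] in [omega], where
     the fibration [p] lifts it. *)
  move=> a b pa; have [|g gE] := dist_extend d (f := b - p ∘ a ∘ r).
    by rewrite compBl -!compmA ri compm1 pa subrr.
  have [g' pg'] := fp W oW g.
  exists (a ∘ r + g' ∘ v); split.
    by rewrite compDl -!compmA ri (dist_vu d) compm1 compm0 addr0.
  by rewrite compDr !compmA pg' -gE addrC subrK.
- move=> A B f; have [W [t [oW ft]]] := fib_copair A B.
  exists (A ⊕ W), in1, (copair f t); rewrite copair_in1.
  have [ci wi] : cof (in1 : hom A (A ⊕ W)) /\ weq (in1 : hom A (A ⊕ W)).
    apply/cof_weqP; split; first by exists pr1; apply: pr1_in1.
    by exists W; split=> //; exists pr2, 0; apply: dist_in1.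
  by split=> //; apply/(CoFibP xi_proper).
- move=> A B f; have [E [j [q [fE cj tq]]]] := cof_tfib_fact f.
  exists E, j, q; split=> //; first exact/(CoFibP xi_proper).
    exact: tfib_fib ext0 _ _ _ tq.
  exact: tfib_weq.
Qed.

(** If [0 -> A] is a weak equivalence, [A] is the third object of a triangle in [xi] whose first two
    lie in [Y], and heredity applies. Conversely the approximation [M] of an [A] in [Y] lies in
    [omega], and [M -> A] is the required witness. *)
Lemma trivial_objP A : trivial_obj weq A <-> Y A.
Proof.
case: (cotorsion) => [_ compl [_ herY]].
split=> [/weq_fact[W [q [[_ YW] [K [k [w [x YK]]]] _]]]|YA].
  by apply: herY x YK _; apply: sub_bip => //; apply: sub_zero.
have [[B [M [u [v [w [YB XM x]]]]]] _] := compl A.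
have tv : tfib v by exists B, u, w.
have oM : omega M by split=> //; apply: Y_extension x YB YA.
apply/(WeqP xi_proper); exists M, v; split=> //.
rewrite /copair comp0m add0r; apply: epi_with_hokernel_iso tv => //.
exact: pr2_zero_iso.
Qed.

(** * The homotopy category *)

Local Notation loc := (loc_functor weq).

(* [(1, a)] and [in1] are both sections of the weak equivalence
   [pr1 : A ⊕ W -> A], so they agree in the localization; composing with [(g, b)]
   gives [g + b ∘ a] and [g]. *)
Lemma loc_factors A B (f g : hom A B) :
  factors_through omega (f - g) -> loc @@ f = loc @@ g.
Proof.
move=> [W [[_ YW] [a [b e]]]].
have wp : weq (pr1 : hom (A ⊕ W) A).
  by apply: tfib_weq => //; apply: pr1_epi_with_hokernel.
have -> : f = copair g b ∘ bpair (idm A) a.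
  by rewrite copair_bpair compm1 -e addrC subrK.
rewrite -[in RHS](copair_in1 g b) !fmorM; congr (_ ∘ _).
by apply: (iso_mono (loc_iso wp)); rewrite -!fmorM pr1_bpair pr1_in1.
Qed.

Definition to_quotient : functor (localization weq) quotient :=
  loc_lift (F := cofrep_functor) weq_cofrep_iso.

Definition from_quotient : functor quotient (localization weq) :=
  quot_lift (R := sub_quot_congruence X omega)
    (F := functor_comp loc (full_inclusion X)) 
    (fun (A B : full_subcategory X) => @loc_factors (sval A) (sval B)).

(** Both natural isomorphisms are given by the replacement maps; on the localization, naturality
    need only be checked on maps coming from [T]. *)
Lemma homotopy_category : equivalent_categories (localization weq) quotient.
Proof.
exists to_quotient, from_quotient; split.
- exists (fun A : T => loc @@ cofrep_map A); split.
    by move=> A; apply/loc_iso/tfib_weq/cofrep_tfib.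
  apply: (loc_natural (H := functor_comp from_quotient to_quotient)
    (K := functor_id _)) => A B f.
  have -> : functor_comp from_quotient to_quotient @@ (loc @@ f) = loc @@ cofrep_lift f.
    have e : to_quotient @@ (loc @@ f) = cls @@ cofrep_lift f by apply: loc_liftE.
    change (from_quotient @@ (to_quotient @@ (loc @@ f)) = loc @@ cofrep_lift f).
    rewrite e; exact: (quot_liftE (F := functor_comp loc (full_inclusion X))).
  apply: etrans (esym (fmorM loc _ _)) _; rewrite cofrep_liftE.
  exact: (fmorM loc).
- exists (fun A : full_subcategory X =>
    cls @@ (cofrep_map (sval A) : hom (cofrep (sval A)) A)).
  split; first by move=> A; apply/tfib_iso/cofrep_tfib.
  move=> A B f; have [g <-] := quot_functor_full f.
  have -> : functor_comp to_quotient from_quotient @@ (cls @@ g) = cls @@ cofrep_lift g.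
    have e : from_quotient @@ (cls @@ g) = loc @@ (g : hom (sval A) (sval B)).
      exact: (quot_liftE (F := functor_comp loc (full_inclusion X))).
    change (to_quotient @@ (from_quotient @@ (cls @@ g)) = cls @@ cofrep_lift g).
    rewrite e; exact: loc_liftE.
  apply: etrans (esym (fmorM cls _ _)) _; apply: etrans (fmorM cls _ _).
  exact: (congr1 (fun h => cls @@ h) (cofrep_liftE g)).
Qed.

End CotorsionToModel.

Theorem theorem1p6 (T : triangulated_category) (xi : triangle T -> Prop)
    (xi_proper : proper_class xi) (X Y : additive_subcategory T) :
  let omega := subcategory_meet X Y in
  let cof := CoFib xi X in
  let fib := Fib omega in
  let weq := Weq xi omega Y in
  (is_model_structure cof fib weq <->
    hereditary_complete_cotorsion_pair xi X Y /\ contravariantly_finite omega) /\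
  (is_model_structure cof fib weq ->
    (forall (A B : T) (f : hom A B),
      cof A B f /\ weq A B f <->
      splitting_mono f /\ exists D, is_hocokernel f D /\ omega D) /\
    (forall (A B : T) (f : hom A B),
      fib A B f /\ weq A B f <->
      proper_epi xi f /\ exists K, is_hokernel f K /\ Y K) /\
    (forall A : T, cofibrant cof A <-> X A) /\
    (forall A : T, fibrant fib A) /\
    (forall A : T, trivial_obj weq A <-> Y A) /\
    equivalent_categories (localization weq) (additive_quotient X omega)).
Proof.
move=> omega cof fib weq.
have model_iff : is_model_structure cof fib weq <->
    hereditary_complete_cotorsion_pair xi X Y /\ contravariantly_finite omega.
  split=> [M|[HC CF]]; last exact: cotorsion_model.
  by split; [apply: model_cotorsion|apply: model_contravariantly_finite M].
split=> // /model_iff[HC CF].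
split=> [A B f|]; first by rewrite -(cof_weqP xi_proper HC) /cof CoFibP.
split=> [A B f|].
  rewrite epi_with_hokernelP //; split=> [[ff wf]|tf].
    exact: (fib_weq_tfib xi_proper ff wf).
  split; first exact: (tfib_fib xi_proper (cotorsion_ext0 HC) tf).
  exact: (tfib_weq xi_proper X tf).
split=> [A|]; first by rewrite /cofibrant /cof CoFibP // cof_from_zero.
split=> [A|]; first exact: fib_to_zero.
split=> [A|]; first exact: trivial_objP.
exact: homotopy_category.
Qed.
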